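(* There exist a real number $\delta>0$ and an absolute constant $C>0$ such that for every odd prime power $q$, every integer $n\geq 3$ and every $\gamma\in\mathbb{F}_q$, $$ \left|\#\mathcal{R}_n(\gamma)-\frac{\#\mathcal{P}(n)}{q}\right|\leq C\, n^{3/2}q^{(1-\delta)n+1}. $$ One can choose $\delta=1/28$.
   Context: $\mathbb{F}_q$ is the finite field with $q$ elements, $q$ an odd prime power. For a monic polynomial $f=t^n+f_{n-1}t^{n-1}+\dots+f_0\in\mathbb{F}_q[t]$ of degree $n\geq 2$, the Rudin-Shapiro function is $$R(f)=\sum_{i=1}^{n-1}f_if_{i-1}\in\mathbb{F}_q.$$ $\mathcal{P}(n)$ is the set of monic irreducible polynomials of degree $n$ in $\mathbb{F}_q[t]$, and for $\gamma\in\mathbb{F}_q$, $$\mathcal{R}_n(\gamma)=\{f\in\mathcal{P}(n): R(f)=\gamma\}.$$ The constant $C$ does not depend on $q$, $n$, $\gamma$. *)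

(* Defs.v *)
From mathcomp Require Import all_boot all_order all_algebra.
From mathcomp Require Import all_classical all_reals all_analysis.

Set Implicit Arguments.
Unset Strict Implicit.
Unset Printing Implicit Defensive.

Import Order.TTheory GRing.Theory Num.Theory.

Local Open Scope ring_scope.

(* The size bound in {poly_(n.+1) F} makes the ambient type finite; the test
   size f == n.+1 says that f has degree exactly n. *)
Definition monic_irr (F : finFieldType) (n : nat) : {set {poly_(n.+1) F}} :=
  [set f : {poly_(n.+1) F} |
    [&& (f : {poly F}) \is monic, size f == n.+1 & irreducibleb f]].

(* The leading coefficient f`_n does not occur in the sum. *)
Definition rudin_shapiro (F : fieldType) (n : nat) (f : {poly F}) : F :=
  \sum_(1 <= i < n) f`_i * f`_i.-1.

Definition rs_irr (F : finFieldType) (n : nat) (gamma : F) :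
    {set {poly_(n.+1) F}} :=
  [set f in monic_irr F n | rudin_shapiro n f == gamma].

(* Finite fields of odd cardinality are exactly the F_q with q an odd prime
   power. The quantifiers over the field come after C, so that C is absolute. *)
Definition rs_equidistribution (R : realType) (delta C : R) : Prop :=
  forall (F : finFieldType), odd #|F| ->
  forall (n : nat), (3 <= n)%N ->
  forall (gamma : F),
  `| #|rs_irr n gamma|%:R - #|monic_irr F n|%:R / #|F|%:R |
    <= C * n%:R `^ (3%:R / 2%:R) * #|F|%:R `^ ((1 - delta) * n%:R + 1).

(* Main.v *)
Require Import Defs.
From mathcomp Require Import all_boot all_order all_algebra.
From mathcomp Require Import all_classical all_reals all_analysis.
From mathcomp Require Import all_field all_fingroup all_character.
From mathcomp Require Import zify ring lra.

(** Write [q = #|F|] and let [psi] be a nontrivial additive character of [F].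
    Up to the coefficient [f_(n-1)], which is additive under multiplication of
    monic polynomials, [R(f)] is the coefficient of [t] in [f(t) f(1/t)].
    Hence [R(gh)] is, up to separate functions of [g] and [h], a bilinear form
    in the autocorrelation vectors of [g] and [h].

    - Bilinear sums: Cauchy-Schwarz and orthogonality of characters reduce
      [\sum_(g,h) a_g b_h psi(R(gh))] to counting pairs with the same
      autocorrelation. If [corr g = corr h], then [h] is determined by
      [gcd(g, h)], so such pairs are controlled by moments of the divisor
      function. This saves about [q^(min(deg g, deg h)/2)].
    - Linear sums [\sum_h psi(R(dh))]: Weyl differencing; the kernel of the
      polar form of [h |-> R(dh)] has dimension at most [deg d + 1], because a
      multiple of [d] in the radical is determined by its low coefficients.

    Vaughan's identity with both cut-offs at [n/5] then gives
    [\sum_p psi(R(p)) << n^O(1) q^(n - n/10 + O(1))], and the margin between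
    [1/10] and [1/28] absorbs the power of [n] uniformly in [q]. *)

Set Implicit Arguments.
Unset Strict Implicit.
Unset Printing Implicit Defensive.

Import Order.TTheory GRing.Theory Num.Theory.

Local Open Scope ring_scope.

(** * Monic polynomials over a finite field and their divisors *)

Lemma leq_expnl a b j : (a <= b)%N -> (a ^ j <= b ^ j)%N.
Proof. by move=> leab; case: j => // j; rewrite leq_exp2r. Qed.

Section Monics.

Variable F : finFieldType.
Implicit Types (d e f g h p : {poly F}) (k l m n : nat).

(** The vector holds the coefficients below the leading one, so that a sum over [monics n] becomes a
    sum over a vector space, as Weyl differencing requires. *)
Definition monic_of n (v : 'rV[F]_n) : {poly F} := 'X^n + rVpoly v.

Definition monics n : seq {poly F} := [seq monic_of v | v <- enum 'rV[F]_n].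

Lemma size_rVpoly n (v : 'rV[F]_n) : (size (rVpoly v) <= n)%N.
Proof. exact: size_poly. Qed.

Lemma monic_of_inj n : injective (@monic_of n).
Proof. by move=> u v /addrI /(can_inj (@rVpolyK _ _)). Qed.

Lemma mem_monics n f : (f \in monics n) = (f \is monic) && (size f == n.+1).
Proof.
apply/mapP/andP => [[v _ ->]|[fM /eqP sf]].
  have s : (size (rVpoly v) < size ('X^n : {poly F}))%N.
    by rewrite size_polyXn ltnS size_rVpoly.
  by rewrite monicE lead_coefDl // lead_coefXn size_polyDl // size_polyXn.
exists (poly_rV f); first by rewrite mem_enum.
apply/polyP=> i; rewrite coefD coefXn coef_rVpoly.
case: insubP => [j _ <- | ]; first by rewrite mxE (ltn_eqF (ltn_ord j)) add0r.
rewrite -leqNgt leq_eqVlt eq_sym => /orP[/eqP->|ltni].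
  by move/monicP: fM; rewrite lead_coefE sf eqxx addr0.
by rewrite nth_default ?sf // gtn_eqF ?addr0.
Qed.

Lemma uniq_monics n : uniq (monics n).
Proof. by rewrite map_inj_uniq ?enum_uniq //; apply: monic_of_inj. Qed.

Lemma size_monics n : size (monics n) = (#|F| ^ n)%N.
Proof. by rewrite size_map -cardE card_mx mul1n. Qed.

Lemma monics_monic n f : f \in monics n -> f \is monic.
Proof. by rewrite mem_monics => /andP[]. Qed.

Lemma monics_size n f : f \in monics n -> size f = n.+1.
Proof. by rewrite mem_monics => /andP[_ /eqP]. Qed.

Lemma monics_neq0 n f : f \in monics n -> f != 0.
Proof. by move/monics_monic/monic_neq0. Qed.

Lemma monic_monics f : f \is monic -> f \in monics (size f).-1.
Proof. by move=> fM; rewrite mem_monics fM prednK ?eqxx ?size_poly_gt0 ?monic_neq0. Qed.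

Lemma monicsM k l d h : d \in monics k -> h \in monics l -> d * h \in monics (k + l).
Proof.
rewrite !mem_monics => /andP[dM /eqP sd] /andP[hM /eqP sh].
by rewrite monicMl // hM size_monicM ?monic_neq0 // sd sh addSn /= addnS eqxx.
Qed.

Lemma monics_divr k l d h : d \in monics k -> d * h \in monics (k + l) -> h \in
  monics l.
Proof.
rewrite !mem_monics => /andP[dM /eqP sd] /andP[dhM sdh].
have hM : h \is monic by rewrite -(monicMl _ dM).
by move: sdh; rewrite hM size_monicM ?monic_neq0 // sd addSn /= -addnS eqn_add2l.
Qed.

Lemma monics_dvd_leq k n d f :
  d \in monics k -> f \in monics n -> d %| f -> (k <= n)%N.
Proof.
move=> dM fM /(dvdp_leq (monics_neq0 fM)).
by rewrite (monics_size dM) (monics_size fM) ltnS.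
Qed.

Lemma monics_divrP k n d f : d \in monics k -> f \in monics n -> d %| f ->
  exists2 h, h \in monics (n - k) & f = d * h.
Proof.
move=> dM fM df; have lekn := monics_dvd_leq dM fM df.
have ef : f = d * (f %/ d) by rewrite mulrC divpK.
exists (f %/ d) => //; apply: (monics_divr dM); rewrite -ef.
by rewrite subnKC.
Qed.

Lemma big_monics (V : nmodType) n (G : {poly F} -> V) :
  \sum_(f <- monics n) G f = \sum_(v : 'rV[F]_n) G (monic_of v).
Proof. by rewrite big_map big_enum. Qed.

Lemma sum_monics_dvd (V : nmodType) k n d (G : {poly F} -> V) :
  d \in monics k -> (k <= n)%N ->
  \sum_(f <- monics n | d %| f) G f = \sum_(h <- monics (n - k)) G (d * h).
Proof.
move=> dM lekn; rewrite -big_filter -(big_map (fun h => d * h) xpredT G).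
apply: perm_big; apply: uniq_perm.
- by rewrite filter_uniq ?uniq_monics.
- by rewrite map_inj_uniq ?uniq_monics //; apply/mulfI/(monics_neq0 dM).
move=> f; rewrite mem_filter; apply/andP/mapP => [[df fM]|[h hM ->]].
  by have [h] := monics_divrP dM fM df; exists h.
by rewrite dvdp_mulr //; have := monicsM dM hM; rewrite subnKC.
Qed.

Definition divisors f : seq {poly F} :=
  [seq d <- flatten [seq monics i | i <- iota 0 (size f)] | d %| f].

Lemma mem_flatten_monics k d :
  (d \in flatten [seq monics i | i <- iota 0 k]) = (d \is monic) && (size d <= k)%N.
Proof.
apply/flattenP/andP => [[s /mapP[i]]|[dM sd]].
  rewrite mem_iota add0n => /andP[_ ltik -> dM].
  by rewrite (monics_monic dM) (monics_size dM).
have d0 : (0 < size d)%N by rewrite size_poly_gt0 monic_neq0.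
exists (monics (size d).-1); last exact: monic_monics.
by apply/mapP; exists (size d).-1; rewrite // mem_iota add0n prednK.
Qed.

Lemma uniq_flatten_monics k : uniq (flatten [seq monics i | i <- iota 0 k]).
Proof.
elim: k => [|k IHk] //; rewrite -addn1 iotaD map_cat flatten_cat /= cats0.
rewrite cat_uniq IHk uniq_monics andbT /=; apply/hasPn => d.
rewrite mem_flatten_monics mem_monics => /andP[-> /eqP ->] /=.
by rewrite -leqNgt add0n.
Qed.

Lemma uniq_divisors f : uniq (divisors f).
Proof. exact/filter_uniq/uniq_flatten_monics. Qed.

Lemma mem_divisors f d : f != 0 -> (d \in divisors f) = (d \is monic) && (d %| f).
Proof.
move=> f0; rewrite mem_filter mem_flatten_monics andbC -andbA; congr (_ && _).
by rewrite andbC; case df: (d %| f); rewrite //= dvdp_leq.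
Qed.

Lemma big_divisors (V : nmodType) n f (G : {poly F} -> V) : f \in monics n ->
  \sum_(d <- divisors f) G d = \sum_(i < n.+1) \sum_(d <- monics i | d %| f) G d.
Proof.
move=> fM; rewrite big_filter big_flatten big_map (monics_size fM).
by rewrite -[iota _ _]/(index_iota 0 n.+1) big_mkord.
Qed.

Lemma sum_monics_divisors (V : nmodType) n (G : {poly F} -> {poly F} -> V) :
  \sum_(f <- monics n) \sum_(d <- divisors f) G d f =
  \sum_(i < n.+1) \sum_(d <- monics i) \sum_(h <- monics (n - i)) G d (d * h).
Proof.
rewrite big_seq (eq_bigr _ (fun f fM => big_divisors (G^~ f) fM)) -big_seq.
rewrite exchange_big /=; apply: eq_bigr => i _.
rewrite (exchange_big_dep predT) //= big_seq [RHS]big_seq; apply: eq_bigr => d dM.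
by rewrite (sum_monics_dvd _ dM) // -ltnS.
Qed.

Definition monic_gcd f g := (lead_coef (gcdp f g))^-1 *: gcdp f g.

Lemma eqp_monic_gcd f g : f != 0 -> monic_gcd f g %= gcdp f g.
Proof.
by move=> f0; rewrite eqp_scale // invr_eq0 lead_coef_eq0 gcdp_eq0 negb_and f0.
Qed.

Lemma monic_gcd_monic f g : f != 0 -> monic_gcd f g \is monic.
Proof.
move=> f0; rewrite monicE lead_coefZ mulVf // lead_coef_eq0 gcdp_eq0 negb_and.
by rewrite f0.
Qed.

Lemma monic_gcd_dvdl f g : f != 0 -> monic_gcd f g %| f.
Proof. by move=> f0; rewrite (eqp_dvdl _ (eqp_monic_gcd g f0)) dvdp_gcdl. Qed.

Lemma monic_gcd_dvdr f g : f != 0 -> monic_gcd f g %| g.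
Proof. by move=> f0; rewrite (eqp_dvdl _ (eqp_monic_gcd g f0)) dvdp_gcdr. Qed.

Lemma coprimep_monic_gcd f g e u v : f != 0 -> e = monic_gcd f g ->
  f = e * u -> g = e * v -> coprimep u v.
Proof.
move=> f0 ee fE gE; have e0 : e != 0 by apply: contraNneq f0; rewrite fE => ->;
  rewrite mul0r.
have := eqp_monic_gcd g f0; rewrite -ee {1}fE {1}gE => eg.
have /(eqp_trans eg) := gcdp_mul2l e u v.
rewrite -{1}[e]mulr1 eqp_mul2l // eqp_sym => e1.
by rewrite -gcdp_eqp1.
Qed.

Definition tau f := size (divisors f).

Lemma tau_gt0 f : f != 0 -> (0 < tau f)%N.
Proof.
move=> f0; have : 1 \in divisors f by rewrite mem_divisors // monic1 dvd1p.
by rewrite /tau; case: (divisors f).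
Qed.

(** A divisor d of f g is recovered from e = gcd(d, f) and d / e. Here e divides f, and d / e, being
    coprime to f / e, divides g. *)
Lemma tauM f g : f != 0 -> g != 0 -> (tau (f * g) <= tau f * tau g)%N.
Proof.
move=> f0 g0; have fg0 : f * g != 0 by rewrite mulf_neq0.
pose split d := (monic_gcd d f, d %/ monic_gcd d f).
rewrite /tau -(size_allpairs pair) -(size_map split).
have dE d : d != 0 -> d = monic_gcd d f * (d %/ monic_gcd d f).
  by move=> d0; rewrite mulrC divpK ?monic_gcd_dvdl.
apply: uniq_leq_size.
  rewrite map_inj_in_uniq ?uniq_divisors // => d1 d2.
  rewrite !mem_divisors // => /andP[/monic_neq0 d10 _] /andP[/monic_neq0 d20 _].
  by case=> e1 e2; rewrite (dE d1) // (dE d2) // e2 e1.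
move=> _ /mapP[d + ->]; rewrite mem_divisors // => /andP[dM dfg].
have d0 := monic_neq0 dM; set u := d %/ monic_gcd d f.
have [v fE] : exists v, f = v * monic_gcd d f by apply/dvdpP/monic_gcd_dvdr.
have eM : monic_gcd d f \is monic by apply: monic_gcd_monic.
apply: allpairs_f; first by rewrite mem_divisors // eM monic_gcd_dvdr.
rewrite mem_divisors // -(monicMl _ eM) -dE // dM /=.
have cuv : coprimep u v.
  by apply: (@coprimep_monic_gcd d f _ u v) => //; [apply: dE|rewrite mulrC].
rewrite -(Gauss_dvdpr _ cuv) -(dvdp_mul2l _ _ (monic_neq0 eM)) -dE //.
by rewrite mulrA [_ * v]mulrC -fE.
Qed.

(** Induction on j: one factor [tau f] is opened as a sum over factorisations f = d h, and [tauM]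
    splits the remaining power. There are n + 1 choices of deg d, so an exponent e of n + 1 becomes
    2 e + 1. *)
Lemma tau_moment j n :
  (\sum_(f <- monics n) tau f ^ j <= n.+1 ^ (2 ^ j).-1 * #|F| ^ n)%N.
Proof.
elim: j n => [|j IHj] n.
  by rewrite expn0 mul1n -(size_monics n) (eq_bigr (fun=> 1%N)) ?sum1_size.
have -> : (\sum_(f <- monics n) tau f ^ j.+1 =
    \sum_(f <- monics n) \sum_(d <- divisors f) tau f ^ j)%N.
  by apply: eq_bigr => f _; rewrite big_const_seq count_predT iter_addn_0 expnSr.
rewrite (sum_monics_divisors (V := nat) n (fun _ f => tau f ^ j)%N).
apply: (@leq_trans (\sum_(i < n.+1) (n.+1 ^ (2 ^ j).-1 * n.+1 ^ (2 ^ j).-1 * #|F| ^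
  n))%N); last first.
  rewrite sum_nat_const card_ord mulnA -expnD -expnS [(2 ^ j.+1)%N]expnS mul2n -addnn.
  by have := expn_gt0 2 j; case: (2 ^ j)%N => // a _; rewrite addSn /= addnS.
apply: leq_sum => i _; have lin : (i <= n)%N by rewrite -ltnS.
apply: (@leq_trans ((\sum_(d <- monics i) tau d ^ j) * (\sum_(h <- monics (n - i))
  tau h ^ j))%N).
  rewrite big_distrl big_seq [X in (_ <= X)%N]big_seq.
  apply: leq_sum => d dM; rewrite big_distrr big_seq [X in (_ <= X)%N]big_seq.
  apply: leq_sum => h hM /=; rewrite -expnMn; apply: leq_expnl.
  exact: tauM (monics_neq0 dM) (monics_neq0 hM).
apply: leq_trans (leq_mul (IHj i) (IHj (n - i)%N)) _.
rewrite mulnACA -expnD subnKC // leq_mul2r; apply/orP; right.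
by apply: leq_mul; rewrite leq_expnl // ltnS leq_subr.
Qed.

End Monics.

(** * Reversal and autocorrelation *)

Section Reversal.

Variable F : fieldType.
Implicit Types (g h p q P Q : {poly F}) (i j k l m n : nat).

(** This is X^k p(1/X). The formal degree k is a parameter because the reversal has degree below k
    when p(0) = 0, while with k fixed reversal is an involution. *)
Definition rev_poly k p : {poly F} := \poly_(i < k.+1) p`_(k - i).

Lemma size_rev_poly k p : (size (rev_poly k p) <= k.+1)%N.
Proof. exact: size_poly. Qed.

Lemma rev_poly_sum k n (c : nat -> F) (P : nat -> {poly F}) :
  rev_poly k (\sum_(a < n) c a *: P a) = \sum_(a < n) c a *: rev_poly k (P a).
Proof.
apply/polyP => i; rewrite coef_poly !coef_sum.
under [RHS]eq_bigr do rewrite coefZ coef_poly.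
case: ltnP => _; last by rewrite big1 // => a _; rewrite mulr0.
by apply: eq_bigr => a _; rewrite coefZ.
Qed.

Lemma rev_polyXM j k a q : (a <= j)%N -> (size q <= k.+1)%N ->
  rev_poly (j + k) ('X^a * q) = 'X^(j - a) * rev_poly k q.
Proof.
move=> leaj sq; apply/polyP => i; rewrite coef_poly !coefXnM coef_poly.
case: ltnP => [lti|lei]; last first.
  case: ltnP => // ?; case: ltnP => // ?; lia.
case: ltnP => [?|?]; first by case: ltnP => // ?; case: ltnP => // ?; lia.
case: ltnP => [?|?]; first by rewrite nth_default //; apply: leq_trans sq _; lia.
by case: ltnP => ?; [congr (_`_ _); lia | lia].
Qed.

Lemma rev_polyM j k p q : (size p <= j.+1)%N -> (size q <= k.+1)%N ->
  rev_poly (j + k) (p * q) = rev_poly j p * rev_poly k q.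
Proof.
move=> sp sq.
have pE : p = \sum_(a < j.+1) p`_a *: 'X^a.
  rewrite -poly_def; apply/polyP => i; rewrite coef_poly.
  by case: ltnP => // ?; rewrite nth_default // (leq_trans sp).
have -> : rev_poly j p = \sum_(a < j.+1) p`_a *: 'X^(j - a).
  rewrite {1}pE (rev_poly_sum j j.+1 (fun a => p`_a) (fun a => 'X^a)).
  apply: eq_bigr => a _; congr (_ *: _); have := @rev_polyXM j 0 a 1.
  rewrite addn0 mulr1 size_poly1 -ltnS ltn_ord => -> //.
  by rewrite /rev_poly poly_def big_ord1 subnn coef1 /= scale1r expr0 mulr1.
rewrite {1}pE !mulr_suml; under eq_bigr do rewrite -scalerAl.
rewrite (rev_poly_sum (j + k) j.+1 (fun a => p`_a) (fun a => 'X^a * q)).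
by apply: eq_bigr => a _; rewrite rev_polyXM -?scalerAl // -ltnS.
Qed.

Lemma rev_polyK k p : (size p <= k.+1)%N -> rev_poly k (rev_poly k p) = p.
Proof.
move=> sp; apply/polyP => i; rewrite !coef_poly.
case: ltnP => lti; last by rewrite nth_default // (leq_trans sp).
by rewrite ltnS leq_subr subKn.
Qed.

Lemma rev_poly_eq0 k p : (size p <= k.+1)%N -> (rev_poly k p == 0) = (p == 0).
Proof.
move=> sp; apply/eqP/eqP => [r0|->]; last first.
  by apply/polyP => i; rewrite coef_poly !coef0 if_same.
by rewrite -(rev_polyK sp) r0; apply/polyP => i; rewrite coef_poly !coef0 if_same.
Qed.

(* The paired monomials through which a product with a palindromic [Q] of
   centre [l] depends only on the upper half of the coefficients of [Q]. *)
Definition pal_monom l j : {poly F} :=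
  if j == 0%N then 'X^(l.+1) else 'X^(l.+1 + j) + 'X^(l.+1 - j).

(** The exponents in [pal_monom] are shifted by one, hence the index k + l + 2 for the coefficient k
    + l + 1 of P Q. The shift leaves room for j = l + 1, where Q_(l+j) = 0. *)
Definition pal_form k l P j : F := (P * pal_monom l j)`_(k + l).+2.

Lemma pal_formB k l P Q j :
  pal_form k l (P - Q) j = pal_form k l P j - pal_form k l Q j.
Proof. by rewrite /pal_form mulrBl coefB. Qed.

Definition palindromic k P :=
  (size P <= (k + k).+1)%N /\ forall i, (i <= k + k)%N -> P`_i = P`_(k + k - i).

Lemma coef_pal_monom l j m : (j <= l.+1)%N ->
  (pal_monom l j)`_m = (j == (m - l.+1) + (l.+1 - m))%N%:R.
Proof.
move=> lej; rewrite /pal_monom; case: (j =P 0%N) => [->|/eqP j0].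
  by rewrite coefXn; congr (_%:R); congr nat_of_bool; apply/eqP/eqP; lia.
rewrite coefD !coefXn -natrD; congr (_%:R); do 3 case: eqP => //=; lia.
Qed.

Lemma palindromic_mul_coef k l P Q : palindromic l Q ->
  (P * Q)`_(k + l).+1 = \sum_(j < l.+2) Q`_(l + j) * pal_form k l P j.
Proof.
case=> sQ symQ.
have QX : Q * 'X = \sum_(j < l.+2) Q`_(l + j) *: pal_monom l j.
  apply/polyP => m; rewrite coefMX coef_sum.
  under eq_bigr => j _ do rewrite coefZ coef_pal_monom -1?ltnS // mulr_natr mulrb.
  rewrite -big_mkcond (big_ord1_eq _ (fun j => Q`_(l + j))) /=.
  have [m0|m0] := eqP.
    by case: ltnP => // _; rewrite nth_default //; apply: leq_trans sQ _; lia.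
  case: ltnP => [ltm|lem]; last by rewrite nth_default //; apply: leq_trans sQ _; lia.
  have [lem|ltlm] := leqP m l; first by rewrite symQ; [congr (_`_ _); lia | lia].
  by congr (_`_ _); lia.
have := congr1 (fun R => (P * R)`_(k + l).+2) QX.
rewrite mulrA coefMX /= => ->; rewrite mulr_sumr coef_sum.
by apply: eq_bigr => j _; rewrite -scalerAr coefZ.
Qed.

(** For j = k + 1 - m the form is P_m + P_(2k+2-m), and symmetry turns the second term into P_(m-2).
    Thus the lower half of P vanishes by induction in steps of two, starting from m < 2, where 2k +
    2 - m exceeds the degree bound 2k. *)
Lemma pal_form_eq0 k l P : palindromic k P -> (k <= l)%N ->
  (forall j, (j < l.+2)%N -> pal_form k l P j = 0) -> P = 0.
Proof.
case=> sP symP lekl P0.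
have P_low m : (m <= k)%N -> P`_m = 0.
  elim/ltn_ind: m => m IHm lemk.
  have := P0 (k.+1 - m)%N; rewrite /pal_form /pal_monom ifN; last by lia.
  rewrite mulrDr coefD !coefMXn ifN; last by lia.
  rewrite ifN; last by lia.
  have -> : ((k + l).+2 - (l.+1 - (k.+1 - m)) = k + k + 2 - m)%N by lia.
  have -> : ((k + l).+2 - (l.+1 + (k.+1 - m)) = m)%N by lia.
  move=> /(_ ltac:(lia)).
  have [ltm2|le2m] := ltnP m 2.
    by rewrite [P`_(_ - m)]nth_default ?addr0 //; apply: leq_trans sP _; lia.
  rewrite [P`_(_ - m)]symP; last by lia.
  have -> : (k + k - (k + k + 2 - m) = m - 2)%N by lia.
  by rewrite [P`_(m - 2)]IHm ?addr0 //; lia.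
apply/polyP => i; rewrite coef0; have [|ltki] := leqP i k; first exact: P_low.
have [lei|?] := leqP i (k + k); first by rewrite symP // P_low //; lia.
by rewrite nth_default //; apply: leq_trans sP _.
Qed.

End Reversal.

(** * Autocorrelation and its fibres *)

Section Correlation.

Variable F : finFieldType.
Implicit Types (e f g h u v : {poly F}) (k l n : nat).

(* The coefficient of [X^(deg g + j)] in [corr g] is the autocorrelation
   [\sum_i g_i g_(i+j)]. *)
Definition corr g := g * rev_poly (size g).-1 g.

Lemma corrE n g : g \in monics F n -> corr g = g * rev_poly n g.
Proof. by rewrite /corr => /monics_size->. Qed.

Lemma corrM k l g h : g \in monics F k -> h \in monics F l ->
  corr (g * h) = corr g * corr h.
Proof.
move=> gM hM; rewrite (corrE gM) (corrE hM) (corrE (monicsM gM hM)).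
by rewrite rev_polyM ?(monics_size gM) ?(monics_size hM) // mulrACA.
Qed.

(** Reversal at formal degree 2n exchanges the two factors, g and its reversal. *)
Lemma corr_palindromic n g : g \in monics F n -> palindromic n (corr g).
Proof.
move=> gM; have sg := monics_size gM; rewrite (corrE gM).
have sr := size_rev_poly n g.
have s : (size (g * rev_poly n g)%R <= (n + n).+1)%N.
  by apply: leq_trans (size_polyMleq _ _) _; rewrite sg addSn /= -addnS leq_add2l.
split=> // i lei; have rr : rev_poly (n + n) (g * rev_poly n g) = g * rev_poly n g.
  by rewrite rev_polyM ?sg // rev_polyK ?sg // mulrC.
by rewrite -{1}rr coef_poly ltnS lei.
Qed.

(* [corr (e u) = corr (e v)] with [u], [v] coprime forces [u] to divide the
   reversal of [v]: so [e = gcd g h] determines [h]. *)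
Lemma corr_eq_determined k u v : u \in monics F k -> v \in monics F k ->
  coprimep u v -> corr u = corr v ->
  v = (lead_coef (rev_poly k u))^-1 *: rev_poly k u.
Proof.
move=> uM vM cuv; rewrite (corrE uM) (corrE vM) => uv.
have su := monics_size uM; have sv := monics_size vM.
have dv : u %| rev_poly k v by rewrite -(Gauss_dvdpr _ cuv) -uv dvdp_mulr.
have /dvdpP[w wE] := dv.
have r0 : rev_poly k v != 0 by rewrite rev_poly_eq0 ?sv // (monics_neq0 vM).
have [w0 u0] : w != 0 /\ u != 0 by apply/andP; rewrite -negb_or -mulf_eq0 -wE.
(* The quotient w is constant: u has degree k and the reversal of v has degree at most k. *)
have : size w = 1%N.
  have := size_rev_poly k v; rewrite wE size_mul // su addnS /= -add1n leq_add2r.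
  by move=> w1; apply/eqP; rewrite eqn_leq w1 size_poly_gt0.
move/eqP/size_poly1P => [c c0 wc].
have vE : v = c *: rev_poly k u.
  rewrite -(rev_polyK (k := k) (p := v)) ?sv // wE wc mul_polyC.
  by apply/polyP => i; rewrite coefZ !coef_poly coefZ; case: ifP; rewrite ?mulr0.
have := monics_monic vM; rewrite monicE vE lead_coefZ => /eqP c1.
by congr (_ *: _); rewrite -[LHS]mulr1 -[1](@mulfV _ (lead_coef (rev_poly k u)));
  [rewrite mulrA c1 mul1r | apply/eqP => l0; move: c1;
    rewrite l0 mulr0 => /esym/eqP; rewrite oner_eq0].
Qed.

(** The map sending h to e = gcd(g, h) is injective on the fibre: with g = e u and h = e v,
    cancelling [corr e] gives [corr u = corr v] with u, v coprime, and then u determines v. *)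
Lemma corr_fiber n g : g \in monics F n ->
  (size [seq h <- monics F n | corr g == corr h] <= tau g)%N.
Proof.
move=> gM; have g0 := monics_neq0 gM.
have sub h : h \in [seq h <- monics F n | corr g == corr h] ->
  [/\ h \in monics F n, corr g = corr h & monic_gcd g h \in divisors g].
  rewrite mem_filter => /andP[/eqP gh hM]; split => //.
  by rewrite mem_divisors // monic_gcd_monic // monic_gcd_dvdl.
rewrite /tau -(size_map (monic_gcd g)); apply: uniq_leq_size; last first.
  by move=> _ /mapP[h /sub[_ _ +] ->].
rewrite map_inj_in_uniq ?filter_uniq ?uniq_monics //.
move=> h1 h2 /sub[h1M c1 e1M] /sub[h2M c2 _] eE.
set e := monic_gcd g h1 in e1M eE.
move: e1M; rewrite mem_divisors // => /andP[eM eg].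
have {}eM := monic_monics eM; move: (size e).-1 eM => m eM.
have [u uM gE] := monics_divrP eM gM eg.
have e0 := monics_neq0 eM.
have main h : h \in monics F n -> corr g = corr h -> e = monic_gcd g h ->
    h = e * ((lead_coef (rev_poly (n - m) u))^-1 *: rev_poly (n - m) u).
  move=> hM ch ee; have eh : e %| h by rewrite ee monic_gcd_dvdr.
  have [v vM hE] := monics_divrP eM hM eh.
  rewrite {1}hE; congr (_ * _); apply: corr_eq_determined => //.
    exact: (coprimep_monic_gcd g0 ee gE hE).
  have ce0 : corr e != 0.
    by rewrite (corrE eM) mulf_neq0 // rev_poly_eq0 // (monics_size eM).
  by apply: (mulfI ce0); rewrite -(corrM eM uM) -(corrM eM vM) -gE -hE.
by rewrite (main h1) // (main h2).
Qed.

(** The coefficient of X^(n+1) in [corr f] is the sum of f_i f_(i-1) for i from 1 to n; its last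
    term is f_(n-1) because f is monic. *)
Lemma rudin_shapiroE n f : (0 < n)%N -> f \in monics F n ->
  rudin_shapiro n f = (corr f)`_n.+1 - f`_n.-1.
Proof.
case: n => // n _ fM; have sf := monics_size fM; rewrite (corrE fM) coefM.
rewrite big_ord_recl /= subn0 {1}/rev_poly coef_poly ltnn mulr0 add0r.
rewrite big_ord_recr /= /bump /= add1n [f`_n.+2]nth_default ?sf // mul0r addr0.
move/monics_monic/monicP: (fM); rewrite lead_coefE sf /= => fl.
rewrite big_ord_recr /= add1n fl mul1r coef_poly.
rewrite (_ : (n.+2 - n.+1 < n.+2)%N); last by lia.
rewrite (_ : (n.+1 - (n.+2 - n.+1) = n)%N); last by lia.
rewrite addrK /rudin_shapiro big_add1 /= big_mkord; apply: eq_bigr => i _.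
rewrite add1n coef_poly /= subSS.
case: ltnP => [_|]; last by lia.
by congr (_ * _`_ _); have := ltn_ord i; lia.
Qed.

(** Up to sign this coefficient is the sum of the roots. Its additivity splits the correction term
    of [rudin_shapiroE] at g h into a function of g and a function of h. *)
Lemma coef_subleadM k l g h : (0 < k)%N -> (0 < l)%N ->
  g \in monics F k -> h \in monics F l ->
  (g * h)`_(k + l).-1 = g`_k.-1 + h`_l.-1.
Proof.
move=> k0 l0 /mapP[u _ ->] /mapP[v _ ->]; rewrite /monic_of.
have su := size_rVpoly u; have sv := size_rVpoly v.
rewrite mulrDl !mulrDr -exprD !coefD coefXnM coefMXn !coefXn.
rewrite !ifN; try lia.
rewrite (_ : ((k + l).-1 == k + l)%N = false); last by lia.
rewrite (_ : (k.-1 == k) = false); last by lia.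
rewrite (_ : (l.-1 == l) = false) ?add0r; last by lia.
rewrite [(rVpoly u * _)`__]nth_default ?addr0.
  by rewrite addrC; congr (_`_ _ + _`_ _); lia.
by apply: leq_trans (size_polyMleq _ _) _; lia.
Qed.

End Correlation.

(** * Additive characters *)

Lemma sum_char_eq0 (V : finZmodType) (chi : V -> algC) w :
  {morph chi : x y / x + y >-> x * y} -> chi w != 1 -> \sum_x chi x = 0.
Proof.
move=> chiD w1; apply/eqP; have : (chi w - 1) * \sum_x chi x == 0.
  rewrite mulrBl mul1r subr_eq0 mulr_sumr [X in _ == X](reindex_inj (addrI w)) /=.
  by apply/eqP; apply: eq_bigr => x _; rewrite chiD.
by rewrite mulf_eq0 subr_eq0 (negPf w1).
Qed.

Section AdditiveCharacters.

Variable F : finFieldType.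

Definition nontrivial_add_char (psi : F -> algC) :=
  [/\ {morph psi : x y / x + y >-> x * y}, forall x, `|psi x| = 1
    & exists x, psi x != 1].

(** An irreducible character of the additive group is taken. If all of them were 1 at the field
    element 1, the regular character would be positive there, whereas it vanishes off the identity,
    which is 0. *)
Lemma exists_nontrivial_add_char : exists psi, nontrivial_add_char psi.
Proof.
pose G := [set: F]%G.
have abG : abelian G by apply: FinRing.zmod_abelian.
have linG (i : Iirr G) : 'chi_i \is a linear_char.
  by move/char_abelianP: abG; apply.
have [i ntriv] : exists i : Iirr G, 'chi_i (1 : F) != 1.
  apply/existsP; rewrite -negb_forall; apply/negP => /forallP all1.
  have := congr1 (fun phi : 'CF(G) => phi (1 : F)) (cfReg_sum G).
  rewrite cfRegE sum_cfunE (_ : _ == _ = false) ?mulr0n; last first.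
    by apply/eqP => /eqP; rewrite oner_eq0.
  under eq_bigr => i _ do rewrite cfunE lin_char1 // (eqP (all1 i)) mul1r.
  by rewrite sumr_const card_ord => /esym/eqP;
    rewrite pnatr_eq0 NirrE eqn0Ngt classes_gt0.
exists (fun x => 'chi_i x); split.
- by move=> x y; rewrite -[x + y]/((x : F) * y)%g (lin_charM (linG i)) ?inE.
- by move=> x; rewrite (normC_lin_char (linG i)) ?inE.
- by exists 1.
Qed.

Section Theory.

Variable psi : F -> algC.
Hypothesis psiP : nontrivial_add_char psi.

Lemma add_charD x y : psi (x + y) = psi x * psi y.
Proof. by case: psiP => ->. Qed.

Lemma norm_add_char x : `|psi x| = 1.
Proof. by case: psiP => _ ->. Qed.

Lemma add_char0 : psi 0 = 1.
Proof.
have n0 : psi 0 != 0 by rewrite -normr_eq0 norm_add_char oner_eq0.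
by apply: (mulfI n0); rewrite -add_charD addr0 mulr1.
Qed.

Lemma add_charB x y : psi (x - y) = psi x * (psi y)^*.
Proof.
have n0 : psi y != 0 by rewrite -normr_eq0 norm_add_char oner_eq0.
apply: (mulIf n0); rewrite -add_charD subrK -mulrA [_^* * _]mulrC -normCK.
by rewrite norm_add_char expr1n mulr1.
Qed.

Lemma nontrivial_add_char_scale c :
  c != 0 -> nontrivial_add_char (fun x => psi (c * x)).
Proof.
move=> c0; split=> [x y|x|]; rewrite ?mulrDr ?add_charD ?norm_add_char //.
by case: psiP => _ _ [x x1]; exists (c^-1 * x); rewrite mulrA divff // mul1r.
Qed.

Lemma sum_add_char_linear m (L : 'rV[F]_m -> F) :
  {morph L : u v / u + v} -> (forall c v, L (c *: v) = c * L v) ->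
  \sum_v psi (L v) = (#|F| ^ m)%:R *+ [forall v, L v == 0].
Proof.
move=> LD LZ; case: (boolP [forall v, L v == 0]) => [/forallP L0|].
  rewrite (eq_bigr (fun=> 1)) => [|v _]; last by rewrite (eqP (L0 v)) add_char0.
  by rewrite sumr_const card_mx mul1n.
rewrite negb_forall => /existsP[v0 Lv0].
case: psiP => _ _ [x x1]; pose w := (x / L v0) *: v0.
have Lw : L w = x by rewrite LZ divfK.
rewrite mulr0n; apply: (@sum_char_eq0 _ _ w); last by rewrite Lw.
by move=> u v; rewrite LD add_charD.
Qed.

Lemma sum_add_char_scale x : \sum_c psi (c * x) = (#|F|)%:R *+ (x == 0).
Proof.
have [->|x0] := eqVneq x 0.
  by rewrite (eq_bigr (fun=> 1)) ?sumr_const // => c _; rewrite mulr0 add_char0.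
case: psiP => _ _ [y y1]; rewrite mulr0n; apply: (@sum_char_eq0 _ _ (y / x)).
  by move=> u v; rewrite mulrDl add_charD.
by rewrite divfK.
Qed.

End Theory.

End AdditiveCharacters.

(** After passing to absolute values u, w, this is Lagrange's identity: twice the difference of the
    two sides is the sum of (u_i w_j - u_j w_i)^2 over all i, j. *)
Lemma Cauchy_Schwarz_sum (I : finType) (x y : I -> algC) :
  `|\sum_i x i * y i| ^+ 2 <= (\sum_i `|x i| ^+ 2) * (\sum_i `|y i| ^+ 2).
Proof.
pose u i := `|x i|; pose w i := `|y i|.
have u0 i : 0 <= u i by apply: normr_ge0.
have w0 i : 0 <= w i by apply: normr_ge0.
have le1 : `|\sum_i x i * y i| <= \sum_i u i * w i.
  by apply: le_trans (ler_norm_sum _ _ _) _; rewrite le_eqVlt;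
    under eq_bigr do rewrite normrM; rewrite eqxx.
apply: le_trans (_ : (\sum_i u i * w i) ^+ 2 <= _).
  by rewrite ler_pXn2r ?nnegrE // sumr_ge0 // => i _; rewrite mulr_ge0.
rewrite -(ler_pMn2r (n := 2)) // expr2 !big_distrlr /=.
have -> : (\sum_i \sum_j u i ^+ 2 * w j ^+ 2) *+ 2 =
    \sum_i \sum_j (u i ^+ 2 * w j ^+ 2 + u j ^+ 2 * w i ^+ 2).
  rewrite mulr2n {2}exchange_big -big_split /=; apply: eq_bigr => i _.
  by rewrite -big_split.
rewrite -sumrMnl; apply: ler_sum => i _; rewrite -sumrMnl; apply: ler_sum => j _.
rewrite -subr_ge0.
have -> : u i ^+ 2 * w j ^+ 2 + u j ^+ 2 * w i ^+ 2 - (u i * w i * (u j * w j)) *+ 2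
  = (u i * w j - u j * w i) ^+ 2 by ring.
by rewrite real_exprn_even_ge0 // rpredB ?realM ?ger0_real.
Qed.

(** * Bilinear sums *)

Section TypeII.

Variable F : finFieldType.
Implicit Types (f g h : {poly F}) (k l n : nat).

(** From 2 tau(g) tau(h) <= tau(g)^2 + tau(h)^2 and symmetry, the sum is at most that of tau(g)^2
    over the same pairs. A fibre of [corr] has at most tau(g) elements, so the third moment of tau
    bounds it, and 7 = 2^3 - 1. *)
Lemma corr_energy_tau n :
  (\sum_(g <- monics F n) \sum_(h <- monics F n | corr g == corr h) tau g * tau h
    <= n.+1 ^ 7 * #|F| ^ n)%N.
Proof.
apply: leq_trans (tau_moment F 3 n); rewrite -(leq_pmul2l (m := 2)) //.
pose T := (\sum_(g <- monics F n) \sum_(h <- monics F n | corr g == corr h) tau g ^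
  2)%N.
apply: (@leq_trans (T + T)).
  rewrite {2}/T; under [X in (_ <= _ + X)%N]eq_bigr do rewrite big_mkcond /=.
  rewrite [X in (_ <= _ + X)%N]exchange_big /= /T -big_split big_distrr /=.
  apply: leq_sum => g _; under [X in (_ <= _ + X)%N]eq_bigr do rewrite eq_sym.
  rewrite -big_mkcond -big_split big_distrr /=; apply: leq_sum => h _.
  exact: (nat_Cauchy _ _).1.
rewrite addnn -mul2n leq_pmul2l // /T big_seq [X in (_ <= X)%N]big_seq.
apply: leq_sum => g gM;
  rewrite -big_filter big_const_seq count_predT iter_addn_0 [(tau g ^ 3)%N]expnSr.
by rewrite leq_mul2l corr_fiber ?orbT.
Qed.

Variable psi : F -> algC.
Hypothesis psiP : nontrivial_add_char psi.

(** The palindrome [corr h] is read from its centre upwards. For h monic of degree l the last entry,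
    of index 2l + 1, is 0. *)
Definition corr_vec l h : 'rV[F]_(l.+2) := \row_j (corr h)`_(l + j).

Lemma corr_vec_inj l h1 h2 : h1 \in monics F l -> h2 \in monics F l ->
  (corr_vec l h1 == corr_vec l h2) = (corr h1 == corr h2).
Proof.
move=> h1M h2M; apply/eqP/eqP => [e|e]; last by apply/rowP => j; rewrite !mxE e.
have [s1 sym1] := corr_palindromic h1M; have [s2 sym2] := corr_palindromic h2M.
have hi i : (l <= i <= l + l)%N -> (corr h1)`_i = (corr h2)`_i.
  move=> /andP[li il]; have lt : (i - l < l.+2)%N by lia.
  by have /rowP/(_ (Ordinal lt)) := e; rewrite !mxE /= subnKC.
apply/polyP => i; have [lti|lei] := ltnP (l + l) i.
  by rewrite !nth_default //; [apply: leq_trans s2 _ | apply: leq_trans s1 _].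
have [li|li] := leqP l i; first by apply: hi; rewrite li.
by rewrite sym1 // sym2 // hi //; lia.
Qed.

Lemma weighted_energy_le n A (a : {poly F} -> algC) : 0 <= A ->
  {in monics F n, forall g, `|a g| <= A * (tau g)%:R} ->
  \sum_(g <- monics F n) \sum_(h <- monics F n | corr g == corr h) `|a g| * `|a h|
    <= A ^+ 2 * (n.+1 ^ 7 * #|F| ^ n)%:R.
Proof.
move=> A0 aA; apply: le_trans (_ : A ^+ 2 * (\sum_(g <- monics F n)
  \sum_(h <- monics F n | corr g == corr h) tau g * tau h)%N%:R <= _); last first.
  by rewrite ler_wpM2l ?exprn_ge0 // ler_nat corr_energy_tau.
rewrite natr_sum mulr_sumr big_seq [X in _ <= X]big_seq; apply: ler_sum => g gM.
rewrite natr_sum mulr_sumr big_seq_cond [X in _ <= X]big_seq_cond.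
apply: ler_sum => h /andP[hM _]; rewrite natrM expr2 mulrACA.
by rewrite ler_pM ?aA.
Qed.

(** The predicate P is left open because the two second moments below produce equality of [corr] in
    different guises: equal vectors in one, equal linear forms in the other. *)
Lemma norm_sum_le_energy n (b : {poly F} -> algC) (P : {poly F} -> {poly F} -> bool)  :
  {in monics F n &, forall g h, P g h = (corr g == corr h)} ->
  `|\sum_(g <- monics F n) \sum_(h <- monics F n | P g h) b g * (b h)^*| <=
  \sum_(g <- monics F n) \sum_(h <- monics F n | corr g == corr h) `|b g| * `|b h|.
Proof.
move=> PE; apply: le_trans (ler_norm_sum _ _ _) _.
rewrite big_seq [X in _ <= X]big_seq; apply: ler_sum => g gM.
apply: le_trans (ler_norm_sum _ _ _) _.
rewrite le_eqVlt -big_filter -[X in _ == X]big_filter; apply/orP; left; apply/eqP.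
rewrite (@eq_in_filter _ (P g) (fun h => corr g == corr h)) => [|h hM]; last exact: PE.
by apply: eq_bigr => h _; rewrite normrM norm_conjC.
Qed.

(* The outer sum is completed to all [v : 'rV_(l.+2)] and not just to the
   [corr_vec l h]; the width [l.+2] is what makes the linear forms attached to
   distinct [corr g] distinct, even when [k = l]. *)
Lemma corr_bilinear_bound k l A B (a b : {poly F} -> algC) :
  (k <= l)%N -> 0 <= A -> 0 <= B ->
  {in monics F k, forall g, `|a g| <= A * (tau g)%:R} ->
  {in monics F l, forall h, `|b h| <= B * (tau h)%:R} ->
  `|\sum_(g <- monics F k) \sum_(h <- monics F l)
      a g * b h * psi (corr (g * h))`_(k + l).+1| ^+ 2
  <= A ^+ 2 * B ^+ 2 * ((k.+1 * l.+1) ^ 7 * #|F| ^ (k + l + l.+2))%:R.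
Proof.
move=> lekl A0 B0 aA bB.
pose form g (v : 'rV[F]_(l.+2)) := \sum_j v 0 j * pal_form k l (corr g) j.
pose Phi v := \sum_(g <- monics F k) a g * psi (form g v).
pose beta v := \sum_(h <- monics F l | corr_vec l h == v) b h.
(* Grouping the h with the same vector v turns the double sum into the pairing of [beta] and [Phi],
   to which Cauchy-Schwarz applies. *)
have -> : \sum_(g <- monics F k) \sum_(h <- monics F l)
    a g * b h * psi (corr (g * h))`_(k + l).+1 = \sum_v beta v * Phi v.
  under [RHS]eq_bigr do rewrite mulr_suml.
  rewrite [RHS](exchange_big_dep xpredT) //= [LHS]exchange_big /= big_seq [RHS]big_seq.
  apply: eq_bigr => h hM; rewrite (big_pred1 (corr_vec l h)) => [|v];
    last by rewrite eq_sym.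
  rewrite mulr_sumr big_seq [RHS]big_seq.
  apply: eq_bigr => g gM; rewrite mulrCA mulrA; congr (_ * psi _).
  rewrite (corrM gM hM) (palindromic_mul_coef _ _ (corr_palindromic hM)).
  by apply: eq_bigr => j _; rewrite mxE.
apply: le_trans (Cauchy_Schwarz_sum _ _) _.
have betaE : \sum_v `|beta v| ^+ 2 = \sum_(g <- monics F l)
    \sum_(h <- monics F l | corr_vec l g == corr_vec l h) b g * (b h)^*.
  under eq_bigr do rewrite normCK rmorph_sum mulr_suml.
  rewrite (exchange_big_dep xpredT) //=; apply: eq_bigr => g _.
  rewrite (big_pred1 (corr_vec l g)) => [|v]; last by rewrite eq_sym.
  rewrite mulr_sumr.
  by apply: eq_bigl => h; rewrite eq_sym.
(* Orthogonality over all v keeps only the pairs g, h whose linear forms coincide. *)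
have PhiE : \sum_v `|Phi v| ^+ 2 = (#|F| ^ l.+2)%:R * \sum_(g <- monics F k)
    \sum_(h <- monics F k | [forall v, form g v - form h v == 0]) a g * (a h)^*.
  under eq_bigr do rewrite normCK rmorph_sum big_distrlr.
  rewrite exchange_big mulr_sumr; apply: eq_bigr => g _.
  rewrite exchange_big mulr_sumr [RHS]big_mkcond; apply: eq_bigr => h _ /=.
  transitivity (\sum_v (a g * (a h)^*) * psi (form g v - form h v)).
    by apply: eq_bigr => v _; rewrite rmorphM mulrACA (add_charB psiP).
  rewrite -mulr_sumr (sum_add_char_linear psiP); first by case: ifP => _;
    rewrite ?mulr0 // mulrC.
    move=> u v; rewrite /form -!sumrB -big_split; apply: eq_bigr => j _ /=.
    by rewrite mxE; ring.
  move=> c v; rewrite /form -!sumrB mulr_sumr; apply: eq_bigr => j _ /=.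
  by rewrite mxE; ring.
have sq_ge0 (G : 'rV[F]_(l.+2) -> algC) : 0 <= \sum_v `|G v| ^+ 2.
  by apply: sumr_ge0 => v _; rewrite exprn_ge0.
have betaB : \sum_v `|beta v| ^+ 2 <= B ^+ 2 * (l.+1 ^ 7 * #|F| ^ l)%:R.
  apply: le_trans (weighted_energy_le B0 bB).
  rewrite -(ger0_norm (sq_ge0 beta)) betaE.
  by apply: norm_sum_le_energy => g h gM hM; apply: corr_vec_inj.
have PhiA : \sum_v `|Phi v| ^+ 2 <=
    (#|F| ^ l.+2)%:R * (A ^+ 2 * (k.+1 ^ 7 * #|F| ^ k)%:R).
  rewrite -(ger0_norm (sq_ge0 Phi)) PhiE normrM normr_nat.
  rewrite ler_wpM2l //; apply: le_trans (weighted_energy_le A0 aA).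
  (* Coinciding forms are tested on the basis vectors; the palindrome [corr g - corr h] then has all
     its [pal_form] equal to 0 and vanishes since k <= l. *)
  apply: norm_sum_le_energy => g h gM hM; apply/forallP/eqP => [P0|gh v]; last first.
    by rewrite /form gh subrr.
  apply/eqP; rewrite -subr_eq0; apply/eqP; apply: (pal_form_eq0 _ lekl).
    have [s1 sym1] := corr_palindromic gM; have [s2 sym2] := corr_palindromic hM.
    split; first by rewrite (leq_trans (size_polyD _ _)) // geq_max s1 size_polyN.
    by move=> i lei; rewrite !coefB sym1 // sym2.
  move=> j ltj; have := P0 (delta_mx 0 (Ordinal ltj)).
  rewrite /form -sumrB (bigD1 (Ordinal ltj)) //= big1 => [|i ij]; last first.
    by rewrite !mxE (negPf ij) !andbF !mul0r subrr.
  by rewrite !mxE !eqxx !mul1r addr0 -pal_formB => /eqP.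
apply: le_trans (ler_pM _ _ betaB PhiA) _; try exact: sq_ge0.
rewrite le_eqVlt; apply/orP; left; apply/eqP.
rewrite expnMn !expnD; move: (#|F| ^ l.+2)%N (#|F| ^ l)%N (#|F| ^ k)%N => c1 c2 c3.
by move: (_ ^ 7)%N (_ ^ 7)%N => c4 c5; rewrite !natrM; ring.
Qed.

(* The twists by [psi (g`_(k-1))] and [psi (h`_(l-1))] are absorbed into the
   weights. *)
Lemma type_II_bound k l A B (a b : {poly F} -> algC) :
  (0 < k)%N -> (k <= l)%N -> 0 <= A -> 0 <= B ->
  {in monics F k, forall g, `|a g| <= A * (tau g)%:R} ->
  {in monics F l, forall h, `|b h| <= B * (tau h)%:R} ->
  `|\sum_(g <- monics F k) \sum_(h <- monics F l)
      a g * b h * psi (rudin_shapiro (k + l) (g * h))| ^+ 2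
  <= A ^+ 2 * B ^+ 2 * ((k.+1 * l.+1) ^ 7 * #|F| ^ (k + l + l.+2))%:R.
Proof.
move=> k0 lekl A0 B0 aA bB; have l0 := leq_trans k0 lekl.
have tw n C (c : {poly F} -> algC) : {in monics F n, forall f, `|c f| <= C * (tau
  f)%:R} ->
    {in monics F n, forall f, `|c f * (psi f`_n.-1)^*| <= C * (tau f)%:R}.
  by move=> cC f fM; rewrite normrM norm_conjC (norm_add_char psiP) mulr1 cC.
have := corr_bilinear_bound lekl A0 B0 (tw _ _ _ aA) (tw _ _ _ bB).
congr (`|_| ^+ 2 <= _); rewrite big_seq [RHS]big_seq; apply: eq_bigr => g gM.
rewrite big_seq [RHS]big_seq; apply: eq_bigr => h hM.
rewrite rudin_shapiroE ?addn_gt0 ?k0 ?monicsM // (coef_subleadM k0 l0 gM hM).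
rewrite (add_charB psiP) (add_charD psiP) rmorphM; ring.
Qed.

End TypeII.

(** * Linear sums *)

Section TypeI.

Variable F : finFieldType.
Implicit Types (d f g h : {poly F}) (k l n : nat).

Definition rs_polar n f g : F := \sum_(1 <= i < n) (f`_i * g`_i.-1 + g`_i * f`_i.-1).

Lemma rudin_shapiroD n f g :
  rudin_shapiro n (f + g) = rudin_shapiro n f + rudin_shapiro n g + rs_polar n f g.
Proof.
rewrite /rudin_shapiro -!big_split; apply: eq_bigr => i _ /=.
by rewrite !coefD; ring.
Qed.

Lemma rs_polarDl n f1 f2 g : rs_polar n (f1 + f2) g = rs_polar n f1 g + rs_polar n f2 g.
Proof. by rewrite -big_split; apply: eq_bigr => i _ /=; rewrite !coefD; ring. Qed.

Lemma rs_polarZl n c f g : rs_polar n (c *: f) g = c * rs_polar n f g.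
Proof. by rewrite mulr_sumr; apply: eq_bigr => i _ /=; rewrite !coefZ; ring. Qed.

Lemma rs_polarBr n f g1 g2 : rs_polar n f (g1 - g2) = rs_polar n f g1 - rs_polar n f g2.
Proof. by rewrite -sumrB; apply: eq_bigr => i _ /=; rewrite !coefB; ring. Qed.

(** Triangularity: d X^(m-k-1) is monic of degree m - 1, so pairing it with g gives g_m plus terms
    in lower coefficients of g. Strong induction on m > k kills the coefficients one after
    another. *)
Lemma rs_polar_eq0 k l d g : d \in monics F k -> (size g <= k + l)%N ->
  (forall j, (j <= k)%N -> g`_j = 0) ->
  (forall i, (i < l)%N -> rs_polar (k + l) (d * 'X^i) g = 0) -> g = 0.
Proof.
move=> dM sg g_low gd; have sd := monics_size dM.
apply/polyP; elim/ltn_ind=> m IHm; rewrite coef0.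
have [|ltkm] := leqP m k; first exact: g_low.
have [?|ltm] := leqP (k + l) m; first by rewrite nth_default // (leq_trans sg).
have := gd (m - k.+1)%N; set f := d * 'X^_; move=> /(_ ltac:(lia)).
have sf : size f = m by rewrite size_Mmonic ?monicXn ?monic_neq0 ?(monics_monic dM)
  // sd size_polyXn; lia.
have fm : f`_m.-1 = 1.
  rewrite -sf -lead_coefE lead_coefM lead_coefXn mulr1.
  exact/monicP/monics_monic/dM.
rewrite /rs_polar (bigD1_seq m) ?iota_uniq ?mem_index_iota ?ltm ?(leq_ltn_trans _
  ltkm) //.
rewrite /= fm mulr1 [f`_m]nth_default ?sf // mul0r add0r big_seq_cond big1 ?addr0 //.
move=> i /andP[_ im]; have [ltim|leim] := ltnP i m.
  by rewrite !IHm ?coef0 ?mulr0 ?mul0r ?addr0 //; lia.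
by rewrite [f`_i]nth_default ?[f`_i.-1]nth_default ?sf ?mulr0 ?mul0r ?addr0 //; lia.
Qed.

(** On the kernel, v is determined by the k + 1 lowest coefficients of d v: for a difference of two
    elements with the same ones they vanish, and [rs_polar_eq0] applies. *)
Lemma card_rs_polar_kernel k l d : d \in monics F k ->
  (#|[set v : 'rV[F]_l | [forall w : 'rV[F]_l,
      rs_polar (k + l) (d * rVpoly w) (d * rVpoly v) == 0%R]]| <= #|F| ^ k.+1)%N.
Proof.
move=> dM; pose low (v : 'rV[F]_l) : 'rV[F]_(k.+1) := \row_j (d * rVpoly v)`_j.
have -> : (#|F| ^ k.+1 = #|{: 'rV[F]_(k.+1)}|)%N by rewrite card_mx mul1n.
apply: (@leq_card_in _ _ low) => u v; rewrite !inE => /forallP u0 /forallP v0 uv.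
have dB : d * rVpoly (u - v) = d * rVpoly u - d * rVpoly v by rewrite raddfB mulrBr.
suff : d * rVpoly (u - v) = 0.
  move/eqP; rewrite mulf_eq0 (negPf (monics_neq0 dM)) /= => /eqP r0.
  by apply/eqP; rewrite -subr_eq0 -[u - v]rVpolyK r0 linear0.
apply: (rs_polar_eq0 (l := l) dM) => [|j lejk|i ltil].
- apply: leq_trans (size_polyMleq _ _) _.
  by rewrite (monics_size dM) leq_add2l size_rVpoly.
- have /rowP/(_ (inord j)) := uv; rewrite !mxE inordK // dB coefB => ->.
  by rewrite subrr.
have := u0 (delta_mx 0 (Ordinal ltil)); have := v0 (delta_mx 0 (Ordinal ltil)).
by rewrite dB rs_polarBr rVpoly_delta => /eqP -> /eqP ->; rewrite subrr.
Qed.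

Variable psi : F -> algC.
Hypothesis psiP : nontrivial_add_char psi.

(** Weyl differencing: in the expanded square, shifting one variable by u leaves psi of
    [C u + L u w], with [L u w] linear in w. The sum over w of psi of [L u w] is q^l or 0, and it is
    q^l for at most q^(k+1) values of u. *)
Lemma type_I_bound k l d : d \in monics F k ->
  `|\sum_(h <- monics F l) psi (rudin_shapiro (k + l) (d * h))| ^+ 2
    <= (#|F| ^ (k + l).+1)%:R.
Proof.
move=> dM; pose L (u w : 'rV[F]_l) := rs_polar (k + l) (d * rVpoly w) (d * rVpoly u).
pose Q (v : 'rV[F]_l) := rudin_shapiro (k + l) (d * monic_of v).
pose C (u : 'rV[F]_l) := rudin_shapiro (k + l) (d * rVpoly u) + rs_polar (k + l) (d
  * 'X^l) (d * rVpoly u).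
have QD (u w : 'rV[F]_l) : Q (w + u) - Q w = C u + L u w.
  rewrite /Q /monic_of raddfD /= addrA mulrDr rudin_shapiroD /C /L.
  by rewrite [d * ('X^l + _)]mulrDr rs_polarDl; ring.
rewrite -[leLHS]ger0_norm ?exprn_ge0 // big_monics normCK rmorph_sum big_distrlr
  exchange_big /=.
under eq_bigr => w _ do rewrite (reindex_inj (addrI w)) /=.
rewrite exchange_big /= (eq_bigr (fun u => psi (C u) *
    (#|F| ^ l)%:R *+ [forall w, L u w == 0])) => [|u _]; last first.
  rewrite -mulrnAr -(sum_add_char_linear psiP) ?mulr_sumr.
  - apply: eq_bigr => w _; rewrite -/(Q _) -/(Q _) -(add_charB psiP) QD.
    exact: (add_charD psiP).
  - by move=> v w; rewrite /L raddfD /= mulrDr rs_polarDl.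
  - by move=> c v; rewrite /L linearZ /= -scalerAr rs_polarZl.
apply: le_trans (ler_norm_sum _ _ _) _.
under eq_bigr do rewrite normrMn normrM (norm_add_char psiP) mul1r normr_nat mulrb.
rewrite -big_mkcond sumr_const -mulrnA ler_nat (_ : (k + l).+1 = l + k.+1)%N;
  last by lia.
rewrite expnD leq_mul2l.
by rewrite -cardsE card_rs_polar_kernel ?orbT.
Qed.

End TypeI.

(** * The Moebius and von Mangoldt functions *)

Section ArithmeticFunctions.

Variable F : finFieldType.
Implicit Types (d e f g h p r : {poly F}) (k l m n N : nat).

Lemma exists_irr_divisor f : f \is monic -> f != 1 ->
  exists p, [/\ p \is monic, irreducibleb p & p %| f].
Proof.
have [n] := ubnP (size f); elim: n f => // n IHn f ltfn fM f1.
case irr: (irreducibleb f); first by exists f; rewrite dvdpp.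
have sf : (1 < size f)%N.
  rewrite ltnNge leq_eqVlt ltnS leqn0 size_poly_eq0 (negPf (monic_neq0 fM)) orbF.
  by rewrite size_poly_eq1 eqp_monic ?monic1.
(* [irreducibleb] tests only divisors of size below that of f, so its failure provides a proper
   nonconstant divisor q. *)
move: irr; rewrite /irreducibleb sf /= => /negbT; rewrite negb_forall => /existsP[q].
rewrite negb_imply -ltnNge => /andP[]; rewrite -Pdiv.Idomain.dvdpE => qf q1.
have q0 : polyn q != 0 by rewrite -size_poly_gt0 ltnW.
pose g := (lead_coef q)^-1 *: polyn q.
have l0 : (lead_coef q)^-1 != 0 by rewrite invr_eq0 lead_coef_eq0.
have gM : g \is monic by rewrite monicE lead_coefZ mulVf // lead_coef_eq0.
have sg : size g = size q by rewrite size_scale.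
have [|//||p [pM pI pg]] := IHn g.
- by rewrite sg (leq_ltn_trans (size_npoly q)) // -ltnS prednK // ltnW.
- by apply: contraTneq q1 => g1; rewrite -sg g1 size_poly1.
by exists p; split=> //; apply: dvdp_trans pg _; rewrite dvdpZl.
Qed.

Definition irrs N : seq {poly F} :=
  [seq p <- flatten [seq monics F i | i <- iota 0 N] | irreducibleb p].

Lemma mem_irrs N p : (p \in irrs N) = [&& p \is monic, irreducibleb p & (size p <=
  N)%N].
Proof. by rewrite mem_filter mem_flatten_monics andbCA. Qed.

Lemma uniq_irrs N : uniq (irrs N).
Proof. exact/filter_uniq/uniq_flatten_monics. Qed.

Lemma irr_size_gt1 p : irreducibleb p -> (1 < size p)%N.
Proof. by case/andP. Qed.

Lemma irr_dvd_irr p r : p \is monic -> r \is monic -> irreducibleb p ->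
  irreducibleb r -> (p %| r) = (p == r).
Proof.
move=> pM rM pI /irreducibleP[_ rI]; rewrite -eqp_monic //.
apply/idP/idP => [/rI|/eqp_dvdl->//]; apply.
by rewrite neq_ltn irr_size_gt1 ?orbT.
Qed.

Lemma irr_dvdM p f g : irreducibleb p -> (p %| f * g) = (p %| f) || (p %| g).
Proof.
move=> /irreducibleP pI; case pf: (p %| f); first by rewrite dvdp_mulr.
by rewrite Gauss_dvdpr // irreducible_poly_coprime // pf.
Qed.

Lemma size_irrX p m : irreducibleb p -> (m < size (p ^+ m))%N.
Proof.
move=> pI; have := size_exp p m; have := irr_size_gt1 pI.
have : (0 < size (p ^+ m))%N by rewrite size_poly_gt0 expf_neq0 // -size_poly_gt0
  ltnW // irr_size_gt1.
by case: (size p) => [|[|s]] //; case: (size _) => //= t _ _ ->; rewrite ltnS leq_pmull.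
Qed.

Definition moebius f : algC :=
  \prod_(p <- divisors f | irreducibleb p) (if p ^+ 2 %| f then 0 else -1).

Lemma norm_moebius_le1 f : `|moebius f| <= 1.
Proof.
rewrite normr_prod; elim/big_rec: _ => // p x _ le1.
by case: ifP => _; rewrite ?normr0 ?mul0r ?ler01 // normrN1 mul1r.
Qed.

Lemma moebius1 : moebius 1 = 1.
Proof.
rewrite /moebius big_seq_cond big1 // => p; rewrite mem_divisors ?oner_eq0 //.
by case/andP=> /andP[_ +] /irr_size_gt1; rewrite dvdp1 => /eqP->.
Qed.

Lemma moebius_irrM p f : p \is monic -> irreducibleb p -> f \is monic ->
  moebius (p * f) = if p %| f then 0 else - moebius f.
Proof.
move=> pM pI fM; have f0 := monic_neq0 fM; have p0 := monic_neq0 pM.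
have pf0 : p * f != 0 by rewrite mulf_neq0.
have pdiv : p \in [seq r <- divisors (p * f) | irreducibleb r].
  by rewrite mem_filter pI mem_divisors // pM dvdp_mulr.
case: ifP => pf.
  by rewrite /moebius -big_filter (big_rem _ pdiv) /= expr2 dvdp_mul2l // pf mul0r.
have perm : perm_eq [seq r <- divisors (p * f) | irreducibleb r]
    (p :: [seq r <- divisors f | irreducibleb r]).
  apply: uniq_perm; first by rewrite filter_uniq ?uniq_divisors.
    by rewrite /= filter_uniq ?uniq_divisors // mem_filter mem_divisors // pf !andbF.
  move=> r; rewrite inE !(mem_filter (fun r : {poly F} => irreducibleb r))
    !mem_divisors //.
  case: (r =P p) => [->|/eqP rp]; first by rewrite pI pM dvdp_mulr.
  case rI: (irreducibleb r); rewrite //=; case rM: (r \is monic) => //=.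
  by rewrite irr_dvdM // irr_dvd_irr // (negPf rp).
rewrite /moebius -big_filter (perm_big _ perm) big_cons /= expr2 dvdp_mul2l // pf
  mulN1r.
congr (- _); rewrite big_filter big_seq_cond [RHS]big_seq_cond; apply: eq_bigr => r.
rewrite mem_divisors // => /andP[/andP[rM rf] rI].
rewrite Gauss_dvdpr // coprimep_expl // irreducible_poly_coprime;
  last exact/irreducibleP.
by rewrite irr_dvd_irr //; apply: contraFN pf => /eqP<-.
Qed.

(** Write f = p g with p irreducible. The divisors divisible by p are the p d with d | g; they
    contribute - mu(d) when p does not divide d and 0 otherwise. The remaining divisors are the d |
    g not divisible by p, and the two parts cancel. *)
Lemma sum_moebius f : f \is monic -> f != 1 -> \sum_(d <- divisors f) moebius d = 0.
Proof.
move=> fM f1; have [p [pM pI pf]] := exists_irr_divisor fM f1.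
have fin : f \in monics F (size f).-1 by apply: monic_monics.
have [g gM fE] := monics_divrP (monic_monics pM) fin pf.
have [f0 p0] := (monic_neq0 fM, monic_neq0 pM); have g0 := monics_neq0 gM.
rewrite (bigID (fun d => p %| d)) /=.
have -> : \sum_(d <- divisors f | p %| d) moebius d =
    \sum_(d <- divisors g) moebius (p * d).
  rewrite -big_filter -(big_map (fun d => p * d) xpredT); apply: perm_big.
  apply: uniq_perm; first by rewrite filter_uniq ?uniq_divisors.
    by rewrite map_inj_uniq ?uniq_divisors //; apply: mulfI.
  move=> d; rewrite mem_filter mem_divisors //;
    apply/andP/mapP => [[pd /andP[dM df]]|[e + ->]].
    have /dvdpP[e eE] := pd; exists e; last by rewrite mulrC.
    by rewrite mem_divisors // -(monicMr _ pM) -eE dM -(dvdp_mul2r _ _ p0) -eE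
      mulrC -fE.
  by rewrite mem_divisors // => /andP[eM eg];
    rewrite dvdp_mulr // monicMl // eM fE dvdp_mul2l.
rewrite big_seq (eq_bigr (fun d => if p %| d then 0 else - moebius d)); last first.
  by move=> d; rewrite mem_divisors // => /andP[dM _]; rewrite moebius_irrM.
rewrite -big_seq (bigID (fun d => p %| d)) /= big1 => [|d ->//]; rewrite add0r.
rewrite (eq_bigr (fun d => - moebius d)) => [|d /negPf->//]; rewrite sumrN addrC.
apply/eqP; rewrite subr_eq0; apply/eqP; rewrite -big_filter -[RHS]big_filter.
apply: perm_big; apply: uniq_perm; try exact/filter_uniq/uniq_divisors.
move=> d; rewrite !(mem_filter (fun d => ~~ (p %| d))) !mem_divisors // fE.
case pd: (p %| d); rewrite //= Gauss_dvdpr // coprimep_sym.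
by rewrite irreducible_poly_coprime ?pd //; apply/irreducibleP.
Qed.

(** The degree of p takes the place of log p. The ranges of p and m serve to make the sum finite;
    [von_mangoldtE] allows any larger common bound. *)
Definition von_mangoldt f : nat :=
  \sum_(p <- irrs (size f)) \sum_(1 <= m < size f) (f == p ^+ m) * (size p).-1.

Lemma big_irrs_widen N M (G : {poly F} -> nat) : (N <= M)%N ->
  (forall p, irreducibleb p -> (N < size p)%N -> G p = 0%N) ->
  (\sum_(p <- irrs M) G p = \sum_(p <- irrs N) G p)%N.
Proof.
move=> leNM G0; rewrite (bigID (fun p => size p <= N)%N) /= addnC big_seq_cond big1.
  rewrite add0n -big_filter; apply: perm_big.
  apply: uniq_perm => [||p]; [exact/filter_uniq/uniq_irrs|exact: uniq_irrs|].
  rewrite (mem_filter (fun p : {poly F} => (size p <= N)%N)) !mem_irrs;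
    case: (leqP (size p) N) => [lepN|]; last by rewrite !andbF.
  by rewrite (leq_trans lepN leNM).
by move=> p; rewrite mem_irrs -ltnNge => /andP[/and3P[_ pI _]]; apply: G0.
Qed.

Lemma big_nat_widen0 N M (G : nat -> nat) : (N <= M)%N ->
  (forall m, (N <= m < M)%N -> G m = 0%N) ->
  (\sum_(1 <= m < M) G m = \sum_(1 <= m < N) G m)%N.
Proof.
case: N => [|N] leNM G0.
  by rewrite [RHS]big_geq // big_nat_cond big1 // => m /andP[/andP[_ ltm] _]; apply: G0.
rewrite (@big_cat_nat _ _ _ N.+1) //= [X in (_ + X)%N]big_nat_cond.
by rewrite [X in (_ + X)%N]big1 ?addn0 // => m /andP[]; move/G0.
Qed.

Lemma von_mangoldtE N f : f != 0 -> (size f <= N)%N ->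
  von_mangoldt f =
    (\sum_(p <- irrs N) \sum_(1 <= m < N) (f == p ^+ m) * (size p).-1)%N.
Proof.
move=> f0 lefN; rewrite [RHS](big_irrs_widen lefN) => [|p pI ltfp].
  apply: eq_big_seq => p; rewrite mem_irrs => /and3P[_ pI _].
  rewrite [RHS](big_nat_widen0 lefN) // => m /andP[lem _].
  case: eqP => // fE; move: lem; rewrite fE.
  by rewrite leqNgt size_irrX.
rewrite big_nat_cond big1 // => m /andP[/andP[m1 _] _]; case: eqP => // fE.
have : p %| f by rewrite fE dvdp_exp ?dvdpp.
by move/(dvdp_leq f0); rewrite leqNgt ltfp.
Qed.

(** This is deg f as the sum of v_p(f) deg p. For f = p g, p^m divides f exactly when p^(m-1)
    divides g, so p gains one term deg p, and the terms of the other irreducibles are those of g. *)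
Lemma sum_valuation N f : f \is monic -> (size f <= N)%N ->
  (\sum_(p <- irrs N) \sum_(1 <= m < N) (p ^+ m %| f)%R * (size p).-1 = (size f).-1)%N.
Proof.
have [n] := ubnP (size f); elim: n f => // n IHn f ltfn fM lefN.
have [->|f1] := eqVneq f 1.
  rewrite size_poly1 /= big_seq_cond big1 // => p.
  rewrite mem_irrs andbT => /and3P[_ pI _];
    rewrite big_nat_cond big1 // => m /andP[/andP[m1 _] _].
  by rewrite dvdp1 gtn_eqF // (leq_ltn_trans m1) // size_irrX.
have [p [pM pI pf]] := exists_irr_divisor fM f1.
have fin : f \in monics F (size f).-1 by apply: monic_monics.
have [g gM fE] := monics_divrP (monic_monics pM) fin pf.
have [f0 p0] := (monic_neq0 fM, monic_neq0 pM); have g0 := monics_neq0 gM.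
have sf : (size f).-1 = ((size p).-1 + (size g).-1)%N.
  rewrite {1}fE size_mul //; have := irr_size_gt1 pI;
    have : (0 < size g)%N by rewrite size_poly_gt0.
  by move: (size p) (size g) => a b; lia.
have s1 := irr_size_gt1 pI.
have sf0 : (0 < size f)%N by rewrite size_poly_gt0.
have sg0 : (0 < size g)%N by rewrite size_poly_gt0.
rewrite sf -(IHn g) ?(monics_monic gM) //; try lia.
have pin : p \in irrs N.
  by rewrite mem_irrs pM pI (leq_trans _ lefN) // dvdp_leq.
rewrite (big_rem p pin) [in RHS](big_rem p pin) /= addnA; congr (_ + _)%N; last first.
  rewrite big_seq [RHS]big_seq; apply: eq_bigr => r.
  rewrite mem_rem_uniq ?uniq_irrs // inE mem_irrs => /andP[rp /and3P[rM rI _]].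
  apply: eq_bigr => m _; congr (nat_of_bool _ * _)%N.
  rewrite fE Gauss_dvdpr // coprimep_expl // irreducible_poly_coprime;
    last exact/irreducibleP.
  by rewrite irr_dvd_irr.
rewrite -!big_distrl -mulSn /=; congr (_ * _)%N; rewrite fE.
case: N lefN pin {IHn} => [|[|N]] lefN pin; first by move: lefN; lia.
  by move: lefN; lia.
rewrite big_ltn // expr1 dvdp_mulr // add1n; congr _.+1.
(* The top exponent N + 1 contributes nothing for g, as the size of p^(N+1) exceeds that of g. *)
rewrite big_add1 [RHS]big_nat_recr //= [p ^+ N.+1 %| g](_ : _ = false) ?addn0.
  apply: eq_bigr => m _; by rewrite exprS dvdp_mul2l.
apply: contraTF lefN => /(dvdp_leq g0); have := size_irrX N.+1 pI; move: sf s1 sf0 sg0.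
by move: (size p) (size g) (size f) (size (p ^+ N.+1)) => a b c d; lia.
Qed.

(** Exchanging the sums counts the prime powers p^m dividing f with weight deg p, which
    [sum_valuation] evaluates. *)
Lemma sum_von_mangoldt f : f \is monic ->
  (\sum_(d <- divisors f) von_mangoldt d = (size f).-1)%N.
Proof.
move=> fM; have f0 := monic_neq0 fM; rewrite -(sum_valuation fM (leqnn _)).
transitivity (\sum_(d <- divisors f) \sum_(p <- irrs (size f))
    \sum_(1 <= m < size f) (d == p ^+ m) * (size p).-1)%N.
  apply: eq_big_seq => d; rewrite mem_divisors // => /andP[dM df].
  by rewrite (@von_mangoldtE (size f)) ?monic_neq0 ?dvdp_leq.
rewrite exchange_big; apply: eq_big_seq => p; rewrite mem_irrs => /and3P[pM pI _].
rewrite exchange_big; apply: eq_bigr => m _ /=; rewrite -big_distrl /=; congr (_ * _)%N.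
have -> : (\sum_(d <- divisors f) (d == p ^+ m) = count_mem (p ^+ m) (divisors f))%N.
  by rewrite -sum1_count [RHS]big_mkcond.
by rewrite count_uniq_mem ?uniq_divisors // mem_divisors // monic_exp.
Qed.

Lemma von_mangoldt_le f : f \is monic -> (von_mangoldt f <= (size f).-1)%N.
Proof.
move=> fM; rewrite -sum_von_mangoldt // (big_rem f) ?leq_addr //=.
by rewrite mem_divisors ?monic_neq0 // fM dvdpp.
Qed.

Lemma von_mangoldt_irr p : p \is monic -> irreducibleb p ->
  von_mangoldt p = (size p).-1.
Proof.
move=> pM pI; have s1 := irr_size_gt1 pI;
  rewrite /von_mangoldt (bigD1_seq p) ?uniq_irrs //=; last first.
  by rewrite mem_irrs pM pI leqnn.
rewrite big_ltn // expr1 eqxx mul1n big_nat_cond big1 ?addn0 => [|m /andP[/andP[m2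
  _] _]].
  rewrite big_seq_cond big1 ?addn0 // => r;
    rewrite mem_irrs => /andP[/and3P[rM rI _] rp].
  rewrite big_nat_cond big1 // => m /andP[/andP[m1 _] _]; case: eqP => // pE.
  by move: rp; rewrite -irr_dvd_irr // pE dvdp_exp ?dvdpp.
case: eqP => // pE; have := size_exp p m; rewrite -pE => e.
move: e s1 m2; case: (size p) => [|[|a]] //= e _ m2.
by have := leq_mul (leqnn a.+1) m2; rewrite -e; lia.
Qed.

(** A reducible prime power p^m of degree n has m >= 2, so deg p <= n/2. There are at most (n+1)
    q^(n/2) such p, n values of m, and a weight of at most n for each. *)
Lemma sum_von_mangoldt_nonirr n :
  (\sum_(f <- monics F n | ~~ irreducibleb f) von_mangoldt f <= n ^ 2 * n.+1 * #|F|
    ^ (n %/ 2))%N.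
Proof.
apply: (@leq_trans (\sum_(p <- irrs (n %/ 2).+1) \sum_(1 <= m < n.+1) n)%N); last first.
  rewrite big_const_seq count_predT iter_addn_0 sum_nat_const_nat subSS subn0 mulnn
    -mulnA leq_mul2l.
  apply/orP; right; apply: (@leq_trans (size (flatten [seq monics F i | i <- iota 0
    (n %/ 2).+1]))).
    by rewrite size_filter count_size.
  rewrite size_flatten /shape -map_comp sumnE big_map -[iota _ _]/(index_iota 0 (n
    %/ 2).+1).
  apply: (@leq_trans (\sum_(0 <= i < (n %/ 2).+1) #|F| ^ (n %/ 2))%N).
    rewrite big_nat_cond [X in (_ <= X)%N]big_nat_cond;
      apply: leq_sum => i /andP[/andP[_ lti] _] /=.
    by rewrite size_monics leq_pexp2l // ltnW // finNzRing_gt1.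
  by rewrite sum_nat_const_nat subn0 leq_mul2r ltnS leq_div orbT.
have le_half : ((n %/ 2).+1 <= n.+1)%N by rewrite ltnS leq_div.
have term0 p m f : irreducibleb p -> ((n %/ 2).+1 < size p)%N -> f \in monics F n ->
    ~~ irreducibleb f -> (1 <= m)%N -> (f == p ^+ m) = false.
  move=> pI ltp fM fI m1; apply: contraNF fI => /eqP fE.
  have := size_exp p m; rewrite -fE (monics_size fM) /=.
  case: m m1 fE => [|[|m]] // _; first by rewrite expr1 => ->.
  move=> _ nE; have : ((size p).-1 * 2 <= n)%N by rewrite nE leq_mul2l orbT.
  by rewrite -leq_divRL //; move: ltp; case: (size p) => //= a;
    rewrite ltnS => /leq_trans H /H; rewrite ltnn.
apply: (@leq_trans (\sum_(p <- irrs n.+1) \sum_(1 <= m < n.+1)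
    \sum_(f <- monics F n | ~~ irreducibleb f) (f == p ^+ m) * (size p).-1)%N).
  under [X in (_ <= X)%N]eq_bigr do rewrite exchange_big /=.
  rewrite [X in (_ <= X)%N]exchange_big /= big_seq_cond [X in (_ <= X)%N]big_seq_cond.
  apply: leq_sum => f /andP[fM _].
  by rewrite (@von_mangoldtE n.+1) ?(monics_neq0 fM) ?(monics_size fM).
rewrite (big_irrs_widen le_half) => [|p pI ltp]; last first.
  rewrite big_nat_cond big1 // => m /andP[/andP[m1 _] _].
  by rewrite big_seq_cond big1 // => f /andP[fM fI]; rewrite (term0 p m f).
rewrite big_seq [X in (_ <= X)%N]big_seq; apply: leq_sum => p;
  rewrite mem_irrs => /and3P[_ _ sp].
apply: leq_sum => m _; rewrite -big_distrl /= -[X in (_ <= X)%N]mul1n; apply: leq_mul.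
  apply: (@leq_trans (count_mem (p ^+ m) (monics F n))).
    rewrite -sum1_count big_mkcond [X in (_ <= X)%N]big_mkcond.
    by apply: leq_sum => f _; case: ifP => //.
  by rewrite count_uniq_mem ?uniq_monics // leq_b1.
by have := leq_trans sp le_half; case: (size p).
Qed.

End ArithmeticFunctions.

(** * Vaughan's identity *)

Section Vaughan.

Variable F : finFieldType.
Implicit Types (d e f g h p r : {poly F}) (i j k l m n U : nat).

(** This is the convolution with 1 of the Moebius function cut at degree U. It is 1 at 1 and
    vanishes in degrees 1 to U, which leaves only long cofactors in Vaughan's identity. *)
Definition moebius_trunc U h : algC :=
  \sum_(d <- divisors h | (size d <= U.+1)%N) moebius d.

Lemma norm_moebius_trunc U h : `|moebius_trunc U h| <= (tau h)%:R.
Proof.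
apply: le_trans (ler_norm_sum _ _ _) _; rewrite /tau -sum1_size natr_sum big_mkcond.
by apply: ler_sum => d _; case: ifP => _; rewrite ?norm_moebius_le1 ?ler01.
Qed.

Lemma moebius_trunc_full U h : h != 0 -> (size h <= U.+1)%N ->
  moebius_trunc U h = \sum_(d <- divisors h) moebius d.
Proof.
move=> h0 sh; rewrite /moebius_trunc big_seq_cond [RHS]big_seq; apply: eq_bigl => d.
case: (boolP (d \in _)) => //=; rewrite mem_divisors // => /andP[_ /(dvdp_leq h0)].
by move/leq_trans; apply.
Qed.

Lemma moebius_trunc1 U : moebius_trunc U (1 : {poly F}) = 1.
Proof.
have n0 := oner_neq0 {poly F}.
rewrite moebius_trunc_full ?size_poly1 // (bigD1_seq 1) ?uniq_divisors //=; last first.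
  by rewrite mem_divisors // monic1 dvd1p.
rewrite moebius1 big_seq_cond big1 ?addr0 // => d; rewrite mem_divisors //.
by case/andP=> /andP[dM]; rewrite dvdp1 size_poly_eq1 eqp_monic ?monic1 // => ->.
Qed.

Lemma moebius_trunc_eq0 U k h : h \in monics F k -> (0 < k <= U)%N ->
  moebius_trunc U h = 0.
Proof.
move=> hM /andP[k0 kU];
  rewrite moebius_trunc_full ?(monics_neq0 hM) ?(monics_size hM) //.
rewrite sum_moebius ?(monics_monic hM) //.
by apply: contraTneq k0 => h1; have := monics_size hM; rewrite h1 size_poly1 => -[<-].
Qed.

Lemma monics0 : monics F 0 = [:: 1].
Proof.
apply: perm_small_eq => //; apply: uniq_perm; rewrite ?uniq_monics // => f.
rewrite mem_monics inE; apply/andP/eqP => [[fM]|->]; last by rewrite monic1 size_poly1.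
by rewrite size_poly_eq1 eqp_monic ?monic1 // => /eqP.
Qed.

(** Both sides run over the pairs of monic e, d with e d dividing f. *)
Lemma exchange_divisors (V : nmodType) f (G : {poly F} -> {poly F} -> V) : f \is
  monic ->
  \sum_(e <- divisors f) \sum_(d <- divisors (f %/ e)) G e d =
  \sum_(d <- divisors f) \sum_(e <- divisors (f %/ d)) G e d.
Proof.
move=> fM; have f0 := monic_neq0 fM.
have divE e d : e \in divisors f ->
    (d \in divisors (f %/ e)) = (d \in divisors f) && (e * d %| f).
  rewrite !(mem_divisors _ f0) => /andP[eM ef]; have e0 := monic_neq0 eM.
  have fE : f = f %/ e * e by rewrite divpK.
  rewrite mem_divisors; last by apply: contraNneq f0 => fe; rewrite fE fe mul0r.
  have -> : (e * d %| f) = (d %| f %/ e) by rewrite {1}fE mulrC dvdp_mul2r.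
  case: (d \is monic) => //=.
  by apply/idP/andP => [dfe|[]//]; split=> //; rewrite fE dvdp_mulr.
have sumE (H : {poly F} -> V) e : e \in divisors f ->
    \sum_(d <- divisors (f %/ e)) H d = \sum_(d <- divisors f | e * d %| f) H d.
  move=> ef; rewrite -[RHS]big_filter; apply: perm_big; apply: uniq_perm.
  - exact: uniq_divisors.
  - exact/filter_uniq/uniq_divisors.
  by move=> d; rewrite (mem_filter (fun d => e * d %| f)) divE // andbC.
rewrite big_seq (eq_bigr _ (fun e ef => sumE (G e) e ef)) -big_seq.
rewrite [RHS]big_seq (eq_bigr _ (fun e ef => sumE (G^~ e) e ef)) -big_seq.
under eq_bigr do rewrite big_mkcond; rewrite exchange_big; apply: eq_bigr => d _ /=.
by rewrite -big_mkcond; apply: eq_bigl => e; rewrite mulrC.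
Qed.

Lemma divpKM e h : e != 0 -> e * h %/ e = h.
Proof. by move=> e0; rewrite mulrC mulpK. Qed.

Lemma sum_moebius_trunc U n (E : {poly F} -> algC) :
  \sum_(h <- monics F n) moebius_trunc U h * E h =
  \sum_(i < n.+1 | (i <= U)%N) \sum_(d <- monics F i)
    moebius d * \sum_(h <- monics F (n - i)) E (d * h).
Proof.
under eq_bigr do rewrite mulr_suml big_mkcond /=.
rewrite (sum_monics_divisors n (fun d f => if (size d <= U.+1)%N then moebius d * E
  f else 0)).
rewrite [RHS]big_mkcond; apply: eq_bigr => i _ /=.
rewrite big_seq; under eq_bigr => d dM do rewrite (monics_size dM) ltnS.
case: ifP => iU; last by rewrite big1 // => d _; rewrite big1.
by rewrite -big_seq; apply: eq_bigr => d _; rewrite mulr_sumr.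
Qed.

(** With mu_U the truncated Moebius function, the convolution Lambda * mu_U * 1 equals mu_U * deg
    because Lambda * 1 = deg. The latter form is the first sum on the right. In the former, e = f
    has cofactor 1 and yields the left side, and the smaller degrees of e yield the subtracted
    sum. *)
Lemma vaughan U n (E : {poly F} -> algC) :
  \sum_(f <- monics F n) (von_mangoldt f)%:R * E f =
  \sum_(i < n.+1 | (i <= U)%N) \sum_(d <- monics F i)
     moebius d * ((n - i)%:R * \sum_(h <- monics F (n - i)) E (d * h))
  - \sum_(j < n) \sum_(e <- monics F j) (von_mangoldt e)%:R *
      \sum_(h <- monics F (n - j)) moebius_trunc U h * E (e * h).
Proof.
apply/eqP; rewrite eq_sym subr_eq; apply/eqP.
transitivity (\sum_(f <- monics F n) \sum_(e <- divisors f)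
    (von_mangoldt e)%:R * moebius_trunc U (f %/ e) * E f); last first.
  rewrite (sum_monics_divisors n (fun e f => (von_mangoldt e)%:R * moebius_trunc U
    (f %/ e) * E f)).
  rewrite big_ord_recr /= addrC subnn; congr (_ + _).
    apply: eq_big_seq => e eM; rewrite monics0 big_seq1 divpKM ?(monics_neq0 eM) //.
    by rewrite mulr1 moebius_trunc1 mulr1.
  apply: eq_bigr => j _; apply: eq_big_seq => e eM; rewrite mulr_sumr.
  by apply: eq_bigr => h _; rewrite divpKM ?(monics_neq0 eM) // mulrA.
transitivity (\sum_(f <- monics F n) \sum_(d <- divisors f)
    (if (size d <= U.+1)%N then moebius d * (n - (size d).-1)%:R * E f else 0));
      last first.
  apply: eq_big_seq => f fM; have fm := monics_monic fM.
  transitivity (E f * \sum_(e <- divisors f) \sum_(d <- divisors (f %/ e))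
      if (size d <= U.+1)%N then (von_mangoldt e)%:R * moebius d else 0); last first.
    rewrite mulr_sumr; apply: eq_bigr => e _; rewrite mulrC; congr (_ * _).
    rewrite mulr_sumr [RHS]big_mkcond; apply: eq_bigr => d _.
    by case: ifP => // _; rewrite mulr0.
  rewrite exchange_divisors // mulr_sumr; apply: eq_big_seq => d.
  rewrite mem_divisors ?monic_neq0 // => /andP[dM df].
  case: ifP => _; last by rewrite big1 ?mulr0.
  have [h hM fE] := monics_divrP (monic_monics dM) fM df.
  rewrite -mulr_suml -natr_sum sum_von_mangoldt; last first.
    by rewrite fE divpKM ?monic_neq0 // (monics_monic hM).
  by rewrite fE divpKM ?monic_neq0 // (monics_size hM) mulrC [_%:R * _]mulrC.
rewrite (sum_monics_divisors n (fun d f => if (size d <= U.+1)%N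
  then moebius d * (n - (size d).-1)%:R * E f else 0)).
rewrite big_mkcond; apply: eq_bigr => i _ /=.
case: ifP => iU; last first.
  rewrite big_seq big1 // => d dM; rewrite big1 // => h _.
  by rewrite (monics_size dM) ltnS iU.
apply: eq_big_seq => d dM; rewrite !mulr_sumr; apply: eq_bigr => h _.
by rewrite (monics_size dM) ltnS iU mulrA.
Qed.

End Vaughan.

(** * The character sum over irreducible polynomials *)

Section MainSum.

Variable F : finFieldType.
Implicit Types (d e f g h p r : {poly F}) (i j k l m n U : nat).
Variable psi : F -> algC.
Hypothesis psiP : nontrivial_add_char psi.

Local Notation q := (#|F|%:R : algC).
(** Powers of the square root of q turn half-integral exponents of q into natural numbers. *)
Local Notation s := (sqrtC q).

Lemma sqrtq_ge0 : 0 <= s. Proof. by rewrite sqrtC_ge0. Qed.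

Lemma sqrtq_ge1 : 1 <= s.
Proof.
rewrite -(@ler_pXn2r _ 2) ?nnegrE ?ler01 ?sqrtq_ge0 // expr1n sqrtCK.
by rewrite ler1n (leq_trans _ (finNzRing_gt1 F)).
Qed.

Lemma sqrtqX m : s ^+ (2 * m) = q ^+ m.
Proof. by rewrite exprM sqrtCK. Qed.

Lemma le_of_sqr (x y : algC) : 0 <= x -> 0 <= y -> x ^+ 2 <= y ^+ 2 -> x <= y.
Proof. by move=> x0 y0; rewrite ler_pXn2r. Qed.

Lemma leq_sqrtqX i j : (i <= j)%N -> s ^+ i <= s ^+ j.
Proof. by move=> leij; rewrite ler_weXn2l ?sqrtq_ge1. Qed.

Lemma type_I_sqrt k n d : d \in monics F k -> (k <= n)%N ->
  `|\sum_(h <- monics F (n - k)) psi (rudin_shapiro n (d * h))| <= s ^+ n.+1.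
Proof.
move=> dM lekn; apply: le_of_sqr; rewrite ?normr_ge0 ?exprn_ge0 ?sqrtq_ge0 //.
have := type_I_bound psiP (n - k) dM; rewrite subnKC // => /le_trans; apply.
by rewrite -exprM mulnC sqrtqX natrX.
Qed.

(** The condition on m says m <= min(k, l). [type_II_bound] is stated for k <= l, so the other case
    exchanges the roles of the two weights; its squared bound with q^(k+l+max(k,l)+2) gives the
    exponent of s. *)
Lemma type_II_sqrt k l A (a b : {poly F} -> algC) m :
  (0 < k)%N -> (0 < l)%N -> 0 <= A -> (maxn k l + m <= k + l)%N ->
  {in monics F k, forall g, `|a g| <= A * (tau g)%:R} ->
  {in monics F l, forall h, `|b h| <= (tau h)%:R} ->
  `|\sum_(g <- monics F k) \sum_(h <- monics F l)
      a g * b h * psi (rudin_shapiro (k + l) (g * h))|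
    <= A * (k.+1 * l.+1)%:R ^+ 4 * s ^+ (2 * (k + l) + 2 - m).
Proof.
move=> k0 l0 A0 km aA bB.
have main k' l' A' B' (a' b' : {poly F} -> algC) :
    (0 < k')%N -> (k' <= l')%N -> (l' + m <= k' + l')%N -> 0 <= A' -> 0 <= B' ->
    {in monics F k', forall g, `|a' g| <= A' * (tau g)%:R} ->
    {in monics F l', forall h, `|b' h| <= B' * (tau h)%:R} ->
    `|\sum_(g <- monics F k') \sum_(h <- monics F l')
      a' g * b' h * psi (rudin_shapiro (k' + l') (g * h))|
    <= A' * B' * (k'.+1 * l'.+1)%:R ^+ 4 * s ^+ (2 * (k' + l') + 2 - m).
  move=> k0' le' lm A0' B0' aA' bB'.
  apply: le_of_sqr; rewrite ?normr_ge0 ?mulr_ge0 ?exprn_ge0 ?ler0n ?sqrtq_ge0 //.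
  apply: le_trans (type_II_bound psiP k0' le' A0' B0' aA' bB') _.
  set Y := _%:R ^+ 4; set Z := s ^+ _.
  rewrite [leRHS](_ : _ = A' ^+ 2 * B' ^+ 2 * (Y ^+ 2 * Z ^+ 2)); last by ring.
  rewrite ler_wpM2l ?mulr_ge0 ?exprn_ge0 // {}/Y {}/Z natrM natrX -!exprM.
  rewrite ler_pM ?exprn_ge0 ?ler0n //; first by rewrite ler_weXn2l // ler1n.
  rewrite [((_ - m) * 2)%N]mulnC sqrtqX -natrX ler_nat.
  by rewrite leq_pexp2l // ?(ltnW (finNzRing_gt1 F)) //; lia.
have [lekl|ltlk] := leqP k l.
  have := main k l A 1 a b k0 lekl; rewrite mulr1; apply => //; first by lia.
  by move=> h hM; rewrite mul1r bB.
have -> : \sum_(g <- monics F k) \sum_(h <- monics F l)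
      a g * b h * psi (rudin_shapiro (k + l) (g * h)) =
    \sum_(h <- monics F l) \sum_(g <- monics F k)
      b h * a g * psi (rudin_shapiro (l + k) (h * g)).
  rewrite exchange_big; apply: eq_bigr => h _; apply: eq_bigr => g _ /=.
  by rewrite [b h * _]mulrC [h * g]mulrC [(l + k)%N]addnC.
have := main l k 1 A b a l0 (ltnW ltlk).
rewrite mul1r [(l.+1 * _)%N]mulnC [(k + l)%N]addnC; apply => //; first by lia.
by move=> h hM; rewrite mul1r bB.
Qed.

(** U is the cut-off of Vaughan's identity. The linear sums with two short factors of degree at most
    U cost s^(4U+n+1), which is within s^(2n+1-U) exactly when 5U <= n. *)
Variables (n U : nat).
Hypothesis UN : (5 * U <= n)%N.

Local Notation N := (n.+1%:R : algC).
Local Notation X := (s ^+ (2 * n + 1 - U)).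

Lemma N_ge1 : 1 <= N. Proof. by rewrite ler1n. Qed.

Lemma leq_NX i j : (i <= 10)%N -> (j <= 2 * n + 1 - U)%N -> N ^+ i * s ^+ j <= N ^+
  10 * X.
Proof.
move=> lei lej; rewrite ler_pM ?exprn_ge0 ?ler0n ?sqrtq_ge0 //.
  by rewrite ler_weXn2l ?N_ge1.
exact: leq_sqrtqX.
Qed.

Lemma norm_sum_monics_trunc (c : {poly F} -> algC) m B : 0 <= B -> (m <= n)%N ->
  (forall i d, (i <= m)%N -> (i <= U)%N -> d \in monics F i -> `|c d| <= B) ->
  `|\sum_(i < m.+1 | (i <= U)%N) \sum_(d <- monics F i) c d| <= N * s ^+ (2 * U) * B.
Proof.
move=> B0 lemn cB; apply: le_trans (ler_norm_sum _ _ _) _.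
apply: (@le_trans _ _ (\sum_(i < m.+1) s ^+ (2 * U) * B)); last first.
  rewrite sumr_const card_ord -[leLHS]mulr_natl mulrA !ler_wpM2r ?exprn_ge0
    ?sqrtq_ge0 //.
  by rewrite ler_nat ltnS.
rewrite big_mkcond; apply: ler_sum => i _; case: ifP => iU; last first.
  by rewrite mulr_ge0 ?exprn_ge0 ?sqrtq_ge0.
apply: le_trans (ler_norm_sum _ _ _) _.
apply: (@le_trans _ _ (\sum_(d <- monics F i) B)).
  rewrite big_seq [leRHS]big_seq; apply: ler_sum => d dM.
  by apply: (cB i) => //; rewrite -ltnS.
rewrite big_const_seq count_predT size_monics iter_addr_0 -[leLHS]mulr_natl
  ler_wpM2r //.
rewrite sqrtqX natrX ler_weXn2l // ler1n.
exact: ltnW (finNzRing_gt1 F).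
Qed.

Local Notation E := (fun f => psi (rudin_shapiro n f)).

Lemma vaughan_linear_le :
  `|\sum_(i < n.+1 | (i <= U)%N) \sum_(d <- monics F i)
     moebius d * ((n - i)%:R * \sum_(h <- monics F (n - i)) E (d * h))| <= N ^+ 10 * X.
Proof.
pose c (d : {poly F}) := moebius d * ((n - (size d).-1)%:R *
  \sum_(h <- monics F (n - (size d).-1)) E (d * h)).
rewrite (eq_bigr (fun i : 'I_n.+1 => \sum_(d <- monics F i) c d)) => [|i _]; last first.
  by apply: eq_big_seq => d dM; rewrite /c (monics_size dM).
apply: le_trans (@norm_sum_monics_trunc c n (N * s ^+ n.+1) _ (leqnn n) _) _.
- by rewrite mulr_ge0 ?ler0n ?exprn_ge0 ?sqrtq_ge0.
- move=> i d lein _ dM; rewrite /c (monics_size dM) /= normrM -[leRHS]mul1r.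
  rewrite ler_pM ?norm_moebius_le1 // normrM normr_nat ler_pM ?ler0n ?type_I_sqrt //.
  by rewrite ler_nat (leq_trans (leq_subr _ _)).
rewrite mulrACA -expr2 -exprD; apply: leq_NX => //; lia.
Qed.

(** There are three ranges of j = deg e. If j <= U, the weight [moebius_trunc] is opened and the
    inner sums are linear. If n - j <= U, that weight vanishes. Otherwise both degrees exceed U and
    the bilinear bound saves s^(U+1). *)
Lemma vaughan_bilinear_le :
  `|\sum_(j < n) \sum_(e <- monics F j) (von_mangoldt e)%:R *
      \sum_(h <- monics F (n - j)) moebius_trunc U h * E (e * h)| <= N ^+ 11 * X.
Proof.
have vM_le j e : e \in monics F j -> (j < n)%N -> (von_mangoldt e <= n)%N.
  move=> eM ltj; apply: leq_trans (von_mangoldt_le (monics_monic eM)) _.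
  by rewrite (monics_size eM) ltnW.
apply: le_trans (ler_norm_sum _ _ _) _.
apply: (@le_trans _ _ (\sum_(j < n) N ^+ 10 * X)); last first.
  rewrite sumr_const card_ord -[leLHS]mulr_natl [N ^+ 11]exprS -mulrA.
  by rewrite ler_wpM2r ?mulr_ge0 ?exprn_ge0 ?ler0n ?sqrtq_ge0 ?ler_nat.
apply: ler_sum => j _; have ltjn := ltn_ord j.
have [lejU|ltUj] := leqP j U.
  apply: le_trans (ler_norm_sum _ _ _) _.
  apply: (@le_trans _ _ (\sum_(e <- monics F j) N * (N * s ^+ (2 * U) * s ^+ n.+1))).
    rewrite big_seq [leRHS]big_seq; apply: ler_sum => e eM.
    rewrite normrM normr_nat ler_pM ?ler0n // ?ler_nat;
      first by rewrite ltnW // ltnS (vM_le j).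
    rewrite sum_moebius_trunc.
    pose c (d : {poly F}) := moebius d *
      \sum_(h <- monics F (n - j - (size d).-1)) E (e * (d * h)).
    rewrite (eq_bigr (fun i : 'I_(n - j).+1 => \sum_(d <- monics F i) c d)) => [|i
      _]; last first.
      by apply: eq_big_seq => d dM; rewrite /c (monics_size dM).
    apply: norm_sum_monics_trunc; rewrite ?leq_subr ?exprn_ge0 ?sqrtq_ge0 //.
    move=> i d lei iU dM; rewrite /c (monics_size dM) /= normrM -[leRHS]mul1r.
    rewrite ler_pM ?norm_moebius_le1 //.
    rewrite -subnDA; under eq_bigr do rewrite mulrA.
    by apply: type_I_sqrt; [apply: monicsM | lia].
  rewrite big_const_seq count_predT size_monics iter_addr_0 -[leLHS]mulr_natl natrX
    -sqrtqX.
  rewrite (_ : _ * _ = N ^+ 2 * s ^+ (2 * j + 2 * U + n.+1));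
    last by rewrite !exprD; ring.
  by apply: leq_NX => //; lia.
have [leU|ltU] := leqP (n - j) U.
  rewrite big1 ?normr0 ?mulr_ge0 ?exprn_ge0 ?ler0n ?sqrtq_ge0 // => e _.
  rewrite big_seq big1 ?mulr0 // => h hM.
  by rewrite (moebius_trunc_eq0 hM) ?mul0r // subn_gt0 ltjn.
under eq_bigr do rewrite mulr_sumr.
under eq_bigr do under eq_bigr do rewrite mulrA.
have := @type_II_sqrt j (n - j) n%:R (fun e => (von_mangoldt e)%:R) (moebius_trunc
  U) U.+1.
rewrite subnKC ?(ltnW ltjn) //; move=> /(_ _ _ _ _ _ _)/le_trans; apply.
- lia.
- lia.
- exact: ler0n.
- lia.
- move=> e eM; rewrite normr_nat -natrM ler_nat; apply: leq_trans (vM_le j e eM ltjn) _.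
  by rewrite leq_pmulr // tau_gt0 // (monics_neq0 eM).
- by move=> h _; apply: norm_moebius_trunc.
apply: (@le_trans _ _ (N ^+ 9 * X)); last by apply: leq_NX.
rewrite (_ : (2 * n + 2 - U.+1 = 2 * n + 1 - U)%N); last by lia.
rewrite ler_wpM2r ?exprn_ge0 ?sqrtq_ge0 // -!natrX -natrM ler_nat.
rewrite (expnS _ 8) leq_mul // (expnM _ 2 4) leq_expnl // -mulnn leq_mul // ltnS
  ?leq_subr // ltnW //.
Qed.

(** For irreducible f the von Mangoldt weight is n, so n times the sum is the full von Mangoldt sum
    minus its part over reducible f. The factor 3 counts the two sums of Vaughan's identity and this
    part. *)
Lemma sum_irr_char_le : (0 < n)%N ->
  `|\sum_(f <- monics F n | irreducibleb f) psi (rudin_shapiro n f)|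
    <= 3 * N ^+ 11 * X.
Proof.
move=> n0.
have irrE : n%:R * \sum_(f <- monics F n | irreducibleb f) E f =
    \sum_(f <- monics F n) (von_mangoldt f)%:R * E f -
    \sum_(f <- monics F n | ~~ irreducibleb f) (von_mangoldt f)%:R * E f.
  rewrite [X in X - _](bigID (fun f => irreducibleb f)) /= addrK mulr_sumr.
  rewrite big_seq_cond [RHS]big_seq_cond; apply: eq_bigr => f /andP[fM fI].
  by rewrite von_mangoldt_irr ?(monics_monic fM) // (monics_size fM).
have le10 : N ^+ 10 * X <= N ^+ 11 * X.
  by rewrite ler_wpM2r ?exprn_ge0 ?sqrtq_ge0 // ler_weXn2l ?N_ge1.
apply: (@le_trans _ _ `|n%:R * \sum_(f <- monics F n | irreducibleb f) E f|).
  by rewrite normrM normr_nat ler_peMl // ler1n.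
rewrite irrE (vaughan U); set T1 := \sum_(i < _ | _) _; set T2 := \sum_(j < _) _.
set T3 := \sum_(f <- _ | _) _.
have T1le : `|T1| <= N ^+ 11 * X by apply: le_trans vaughan_linear_le _.
have T2le : `|T2| <= N ^+ 11 * X by apply: vaughan_bilinear_le.
have T3le : `|T3| <= N ^+ 11 * X.
  apply: le_trans le10; apply: le_trans (ler_norm_sum _ _ _) _.
  apply: (@le_trans _ _ (n ^ 2 * n.+1 * #|F| ^ (n %/ 2))%N%:R).
    apply: le_trans _ (_ : (\sum_(f <- monics F n | ~~ irreducibleb f) von_mangoldt
      f)%N%:R <= _).
      rewrite natr_sum; apply: ler_sum => f _.
      by rewrite normrM normr_nat (norm_add_char psiP) mulr1.
    by rewrite ler_nat sum_von_mangoldt_nonirr.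
  apply: (@le_trans _ _ (N ^+ 3 * s ^+ (2 * (n %/ 2)))).
    rewrite sqrtqX natrM natrX ler_wpM2r ?exprn_ge0 // -natrX ler_nat.
    by rewrite (expnSr _ 2) leq_mul // leq_expnl.
  by apply: leq_NX => //; lia.
rewrite -mulrA (_ : 3 * _ = N ^+ 11 * X + N ^+ 11 * X + N ^+ 11 * X); last by ring.
apply: le_trans (ler_normB _ _) _; apply: lerD => //.
by apply: le_trans (ler_normB _ _) _; apply: lerD.
Qed.

End MainSum.

(** * Counting *)

Section Counting.

Variable F : finFieldType.

Lemma card_npoly_monics n (P : pred {poly F}) :
  #|[set f : {poly_(n.+1) F} | [&& (f : {poly F}) \is monic, size f == n.+1 & P f]]|
    = count P (monics F n).
Proof.
rewrite cardE -size_filter -(size_map (@polyn F n.+1)); apply: perm_size.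
apply: uniq_perm; first by rewrite map_inj_uniq ?enum_uniq //; apply: val_inj.
  by rewrite filter_uniq ?uniq_monics.
move=> f; rewrite mem_filter mem_monics; apply/mapP/idP => [[g + ->]|/and3P[Pf fM sf]].
  by rewrite mem_enum inE => /and3P[-> -> ->].
have sf' : (size f <= n.+1)%N by rewrite (eqP sf).
by exists (NPoly sf'); rewrite // mem_enum inE /= fM sf Pf.
Qed.

Lemma card_monic_irr n : #|monic_irr F n| = count (@irreducibleb F) (monics F n).
Proof. by rewrite -card_npoly_monics. Qed.

Lemma card_rs_irr n (gamma : F) : #|rs_irr n gamma| =
  count (fun f => irreducibleb f && (rudin_shapiro n f == gamma)) (monics F n).
Proof.
rewrite -card_npoly_monics; apply: eq_card => f.
by rewrite !inE -!andbA.
Qed.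

(** Squaring makes both sides integers, which carries the bound from [algC] over to any [realType];
    9 and 22 come from squaring 3 and (n+1)^11. The cut-off is U = n/5 rounded down. *)
Lemma rs_irr_discrepancy n (gamma : F) : (0 < n)%N ->
  (#|F|%:Z * #|rs_irr n gamma|%:Z - #|monic_irr F n|%:Z) ^+ 2 <=
  (#|F| ^ 2 * (9 * n.+1 ^ 22 * #|F| ^ (2 * n + 1 - n %/ 5)))%N%:Z.
Proof.
move=> n0; have [psi psiP] := exists_nontrivial_add_char F.
set x := _ - _; pose s : algC := sqrtC #|F|%:R.
pose B : algC := 3 * n.+1%:R ^+ 11 * s ^+ (2 * n + 1 - n %/ 5).
have B0 : 0 <= B by rewrite !mulr_ge0 ?exprn_ge0 ?ler0n ?sqrtq_ge0.
have cB c : c != 0 -> `|\sum_(f <- monics F n | irreducibleb f)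
    psi (c * (rudin_shapiro n f - gamma))| <= B.
  move=> c0; have cP := nontrivial_add_char_scale psiP c0.
  rewrite (eq_bigr (fun f => psi (c * rudin_shapiro n f) * (psi (c * gamma))^*)) =>
    [|f _].
    rewrite -mulr_suml normrM norm_conjC (norm_add_char psiP) mulr1.
    by apply: (sum_irr_char_le cP) => //; lia.
  by rewrite mulrBr (add_charB psiP).
(* Orthogonality in c: q times the indicator of R(f) = gamma is the sum of psi(c (R(f) - gamma))
   over all c, and c = 0 contributes the main term. *)
have xE : x%:~R = \sum_(c : F | c != 0) \sum_(f <- monics F n | irreducibleb f)
    psi (c * (rudin_shapiro n f - gamma)).
  have sum_c y : \sum_(c : F | c != 0) psi (c * y) = #|F|%:R *+ (y == 0) - 1.
    rewrite -(sum_add_char_scale psiP) [in RHS](bigD1 0) //= mul0r (add_char0 psiP).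
    by rewrite addrAC subrr add0r.
  rewrite rmorphB rmorphM /= -!pmulrn card_rs_irr card_monic_irr exchange_big /=.
  under [RHS]eq_bigr do rewrite sum_c subr_eq0.
  rewrite sumrB -!sum1_count !natr_sum; congr (_ - _).
  rewrite big_mkcondr mulr_sumr; apply: eq_bigr => f _.
  by case: ifP; rewrite ?mulr1 ?mulr0.
have xB : `|x%:~R| <= #|F|%:R * B.
  rewrite xE; apply: le_trans (ler_norm_sum _ _ _) _.
  apply: (@le_trans _ _ (\sum_(c : F) B)); last by rewrite sumr_const -[leLHS]mulr_natl.
  by rewrite big_mkcond; apply: ler_sum => c _; case: ifP => // /cB.
have -> : x ^+ 2 = `|x| ^+ 2 by rewrite -normrX ger0_norm // sqr_ge0.
rewrite -(ler_int algC) rmorphXn /= intr_norm -pmulrn.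
have -> : (#|F| ^ 2 * (9 * n.+1 ^ 22 * #|F| ^ (2 * n + 1 - n %/ 5)))%N%:R =
    (#|F|%:R * B) ^+ 2 :> algC.
  rewrite !exprMn [s ^+ _ ^+ 2]exprAC sqrtCK natrM natrX !natrM !natrX.
  by move: (_ ^+ (2 * n + 1 - _)) => Y; ring.
by rewrite ler_pXn2r ?nnegrE ?normr_ge0 ?(mulr_ge0 _ B0) ?ler0n.
Qed.

End Counting.

(** * The power of n and the final exponents *)

(* [n + 1 <= 220 2^(n/220)], raised to the 22nd power. *)
Lemma leq_pow22 n : (n.+1 ^ 22 <= 220 ^ 22 * 2 ^ (22 * (n %/ 220)))%N.
Proof.
rewrite mulnC [(2 ^ _)%N](_ : _ = (2 ^ (n %/ 220)) ^ 22)%N;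
  last by rewrite -expnM mulnC.
rewrite -expnMn leq_expnl // (@leq_trans ((n %/ 220).+1 * 220)) //.
  by rewrite ltn_ceil.
by rewrite leq_mul2r ltn_expl ?orbT.
Qed.

(** As q >= 2, [leq_pow22] absorbs (n+1)^22 into 220^22 q^(n/10), and C = 3 * 220^11 is the square
    root of 9 * 220^22. The factor n^(3/2) >= 1 enters at the very end. *)
Lemma rs_equidistribution_28 (R : realType) :
  rs_equidistribution (1 / 28%:R) (3 * 220%:R ^+ 11 : R).
Proof.
move=> F _ n n3 gamma; set q := #|F|; have q2 : (1 < q)%N := finNzRing_gt1 F.
have q0 : (0 : R) < q%:R by rewrite ltr0n ltnW.
set a := #|_|; set b := #|_|; set e := (_ * _ + 1).
have n0 : (0 < n)%N := leq_trans (isT : (0 < 3)%N) n3.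
have disc := rs_irr_discrepancy gamma n0; rewrite -/q -/a -/b in disc.
(* Multiplying by q and squaring leads back to the integer inequality. *)
have : (`|a%:R - b%:R / q%:R| * q%:R) ^+ 2 <= (3 * 220%:R ^+ 11 * q%:R `^ e * q%:R)
  ^+ 2 :> R.
  have -> : `|a%:R - b%:R / q%:R| * q%:R = `|(q%:Z * a%:Z - b%:Z)%:~R| :> R.
    rewrite rmorphB rmorphM /= -!pmulrn -[X in _ * X]gtr0_norm // -normrM mulrBl.
    by rewrite divfK ?gt_eqF // mulrC.
  rewrite -normrX ger0_norm ?sqr_ge0 // -rmorphXn /=.
  apply: le_trans (_ : (q ^ 2 * (9 * n.+1 ^ 22 * q ^ (2 * n + 1 - n %/
    5)))%N%:Z%:~R <= _).
    by rewrite ler_int.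
  have powle : (q ^ (22 * (n %/ 220) + (2 * n + 1 - n %/ 5)))%:R <= (q%:R `^ e) ^+
    2 :> R.
    rewrite natrX -!powR_mulrn ?powR_ge0 ?ler0n // -powRrM.
    apply: ler_powR; first by rewrite ler1n ltnW.
    (* Rounding included, k <= 1.9 n + 1.8, against 2 e = (27/14) n + 2. *)
    set k := (_ + _)%N; have : (14 * k <= 27 * n + 28)%N by rewrite /k; lia.
    by rewrite -(ler_nat R) natrD !natrM /e => ?; lra.
  rewrite -pmulrn.
  apply: le_trans (_ : (q ^ 2 * (9 * 220 ^ 22 * q ^ (22 * (n %/ 220) + (2 * n + 1 -
    n %/ 5))))%N%:R <= _).
    rewrite ler_nat leq_mul2l expnD; apply/orP; right; rewrite mulnA leq_mul2r;
      apply/orP; right.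
    rewrite -mulnA leq_mul2l; apply/orP; right.
    apply: leq_trans (leq_pow22 n) _; rewrite leq_mul2l; apply/orP; right.
    exact: leq_expnl.
  rewrite natrM natrX natrM (natrM _ 9) (natrX _ 220).
  rewrite (_ : (3 * _ * _ * _) ^+ 2 = q%:R ^+ 2 * (9 * 220%:R ^+ 22 * (q%:R `^ e)
    ^+ 2)); last first.
    by move: (q%:R `^ e) => Y; rewrite (exprM _ 11 2); move: (220%:R ^+ 11) => Z; ring.
  by rewrite !ler_wpM2l ?mulr_ge0 ?exprn_ge0 ?ler0n.
rewrite ler_pXn2r ?nnegrE ?mulr_ge0 ?exprn_ge0 ?powR_ge0 ?ler0n // ler_pM2r //.
move/le_trans; apply; rewrite ler_wpM2r ?powR_ge0 //.
rewrite ler_peMr ?mulr_ge0 ?exprn_ge0 //.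
apply: (@le_trans _ _ (n%:R `^ 0)); first by rewrite powRr0.
apply: ler_powR; first by rewrite ler1n.
by rewrite divr_ge0.
Qed.

Theorem theorem1 (R : realType) :
  (exists delta C : R,
    [/\ 0 < delta, 0 < C & rs_equidistribution delta C]) /\
  (exists C : R, 0 < C /\ rs_equidistribution (1 / 28%:R) C).
Proof.
have C0 : 0 < 3 * 220%:R ^+ 11 :> R by rewrite mulr_gt0 ?exprn_gt0 ?ltr0n.
split; last by exists (3 * 220%:R ^+ 11); split=> //; apply: rs_equidistribution_28.
exists (1 / 28%:R), (3 * 220%:R ^+ 11); split=> //; exact: rs_equidistribution_28.
Qed.
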